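(* Let $m\ge 2$ and let $p_1,\ldots,p_m\in[1,\infty]$ be such that $\frac12\le\frac1{p_2}+\cdots+\frac1{p_m}<1$ and $$\frac1{p_1}+\cdots+\frac1{p_m}=1.$$ Put $$k_0:=\max\left\{t\in\{1,\ldots,m\}:\ \frac1{p_t}+\cdots+\frac1{p_m}\ge\frac12\right\}$$ and $$s_k=\begin{cases}\left[1-\left(\frac1{p_k}+\cdots+\frac1{p_m}\right)\right]^{-1}, & \text{if } 1\le k\le k_0,\\ 2, & \text{if } k>k_0\end{cases}$$ (so that $s_1=\infty$). Then there is a constant $C_m$, depending only on $m$, such that $$\left(\sum_{j_1=1}^n\left(\cdots\left(\sum_{j_m=1}^n|A(e_{j_1},\ldots,e_{j_m})|^{s_m}\right)^{\frac{s_{m-1}}{s_m}}\cdots\right)^{\frac{s_1}{s_2}}\right)^{\frac1{s_1}}\le C_m\|A\|$$ for all positive integers $n$ and all $m$-linear forms $A\colon\ell_{p_1}^n\times\cdots\times\ell_{p_m}^n\to\mathbb K$. Moreover: (i) the exponents $s_1,\ldots,s_{k_0}$ are optimal; (ii) if $p_{k_0}\ge2$, the $m$-tuple of exponents $(s_1,\ldots,s_m)$ is globally sharp.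
   Context: $\mathbb K=\mathbb R$ or $\mathbb C$; $\ell_p^n$ is $\mathbb K^n$ with the $\ell_p$ norm; $e_j$ are the canonical unit vectors; $1/\infty=0$, $1/0=\infty$. For an $m$-linear form $A\colon\ell_{p_1}^n\times\cdots\times\ell_{p_m}^n\to\mathbb K$, $\|A\|:=\sup\{|A(z^{(1)},\ldots,z^{(m)})|:\ \|z^{(j)}\|_{\ell_{p_j}^n}\le 1,\ j=1,\ldots,m\}$. When an exponent equals $\infty$, the corresponding $\left(\sum_j|a_j|^s\right)^{1/s}$ denotes $\sup_j|a_j|$; thus the left-hand side of the inequality is $\sup_{j_1}\left(\sum_{j_2=1}^n\left(\cdots\left(\sum_{j_m=1}^n|A(e_{j_1},\ldots,e_{j_m})|^{s_m}\right)^{\frac{s_{m-1}}{s_m}}\cdots\right)^{\frac{s_2}{s_3}}\right)^{\frac1{s_2}}$. For fixed $p_1,\ldots,p_m$, call $(t_1,\ldots,t_m)\in(0,\infty]^m$ admissible if there is a constant $C$ (not depending on $n$ or $A$) such that $$\left(\sum_{j_1=1}^n\left(\cdots\left(\sum_{j_m=1}^n|A(e_{j_1},\ldots,e_{j_m})|^{t_m}\right)^{\frac{t_{m-1}}{t_m}}\cdots\right)^{\frac{t_1}{t_2}}\right)^{\frac1{t_1}}\le C\|A\|$$ (iterated $\ell_{t_m},\ldots,\ell_{t_1}$ norms, with suprema for infinite exponents) for all positive integers $n$ and all $m$-linear forms $A\colon\ell_{p_1}^n\times\cdots\times\ell_{p_m}^n\to\mathbb K$. The exponent $s_k$ at position $k$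 is optimal if every admissible $(t_1,\ldots,t_m)$ satisfies $t_k\ge s_k$. An $m$-tuple $(t_1,\ldots,t_m)$ is globally sharp if it is admissible and, for every $j\in\{1,\ldots,m\}$ and every $0<t_j'<t_j$, the $m$-tuple $(t_1,\ldots,t_{j-1},t_j',t_{j+1},\ldots,t_m)$ is not admissible. *)

(* Defs.v *)
From HB Require Import structures.
From mathcomp Require Import all_boot all_order all_algebra.
From mathcomp Require Import complex.
From mathcomp Require Import all_classical all_reals all_analysis.

Set Implicit Arguments.
Unset Strict Implicit.
Unset Printing Implicit Defensive.

Import Order.TTheory GRing.Theory Num.Theory.

Local Open Scope classical_set_scope.
Local Open Scope ring_scope.

Variant scalar_kind := RealScalars | ComplexScalars.

Definition scalars (R : realType) (F : scalar_kind) : numFieldType :=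
  match F with
  | RealScalars => R
  | ComplexScalars => R[i]%C
  end.

(* The canonical norm of a numFieldType is valued in the field itself; this is
   the R-valued absolute value, resp. modulus. *)
Definition modulus (R : realType) (F : scalar_kind) : scalars R F -> R :=
  match F return scalars R F -> R with
  | RealScalars => fun x : R => `|x|
  | ComplexScalars => fun z : R[i]%C => ComplexField.Normc.normc z
  end.

(* The l_q (quasi-)norm of a finite real family for 0 < q <= +oo; the value at
   other q is irrelevant. *)
Definition lnorm (R : realType) (n : nat) (q : \bar R) (a : 'I_n -> R) : R :=
  match q with
  | r%:E => (\sum_(i < n) `|a i| `^ r) `^ r^-1
  | _ => \big[Num.max/0]_(i < n) `|a i|
  end.

Definition ord_cons (m n : nat) (i : 'I_n) (j : 'I_m -> 'I_n) :
    'I_m.+1 -> 'I_n :=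
  fun k => if unlift ord0 k is Some k' then j k' else i.

(* Iterated norms of a family indexed by (j_1, ..., j_m): the l_(t_1) norm in
   j_1 is the outermost one and the l_(t_m) norm in j_m the innermost one. *)
Fixpoint mixed_norm (R : realType) (n m : nat) :
    ('I_m -> \bar R) -> (('I_m -> 'I_n) -> R) -> R :=
  match m return ('I_m -> \bar R) -> (('I_m -> 'I_n) -> R) -> R with
  | 0 => fun _ a => a (fun k : 'I_0 => match notF (ltn_ord k) with end)
  | m'.+1 => fun t a =>
      lnorm (t ord0) (fun i : 'I_n =>
        mixed_norm (fun k : 'I_m' => t (lift ord0 k))
                   (fun j => a (ord_cons i j)))
  end.

Definition replace_at (m : nat) (T : Type) (z : 'I_m -> T) (k : 'I_m) (u : T) :
    'I_m -> T :=
  fun k' => if k' == k then u else z k'.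

Section MultilinearForms.
Variables (R : realType) (F : scalar_kind) (m n : nat).
Let K := scalars R F.

Definition multilinear_form (A : ('I_m -> 'rV[K]_n) -> K) : Prop :=
  forall (z : 'I_m -> 'rV[K]_n) (k : 'I_m),
    scalar (fun u : 'rV[K]_n => A (replace_at z k u)).

Definition form_coef (A : ('I_m -> 'rV[K]_n) -> K) (j : 'I_m -> 'I_n) : R :=
  modulus (A (fun k => delta_mx 0 (j k))).

Definition form_norm (p : 'I_m -> \bar R) (A : ('I_m -> 'rV[K]_n) -> K) : R :=
  sup [set modulus (A z) | z in
        [set z : 'I_m -> 'rV[K]_n |
          forall k, lnorm (p k) (fun i => modulus (z k 0 i)) <= 1]].

End MultilinearForms.

Section Exponents.
Variables (R : realType) (m : nat).
Implicit Types (p t : 'I_m -> \bar R) (k : 'I_m).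
Local Open Scope ereal_scope.

Definition admissible (F : scalar_kind) p t : Prop :=
  (forall k, 0 < t k) /\
  exists C : R, forall (n : nat) (A : ('I_m -> 'rV[scalars R F]_n) -> scalars R F),
    (0 < n)%N -> multilinear_form A ->
    (mixed_norm t (form_coef A) <= C * form_norm p A)%R.

Definition optimal_at (F : scalar_kind) p (s : 'I_m -> \bar R) k : Prop :=
  forall t, admissible F p t -> s k <= t k.

Definition globally_sharp (F : scalar_kind) p t : Prop :=
  admissible F p t /\
  forall k (t' : \bar R), 0 < t' -> t' < t k ->
    ~ admissible F p (replace_at t k t').

(* Positions are numbered from 0.  On \bar R the inverse satisfies
   +oo^-1 = 0 and 0^-1 = +oo. *)
Definition tail_sum p (k : nat) : \bar R := \sum_(j < m | (k <= j)%N) (p j)^-1.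

Definition is_k0 p (k0 : 'I_m) : Prop :=
  2^-1 <= tail_sum p k0 /\
  forall k, 2^-1 <= tail_sum p k -> (k <= k0)%N.

Definition exponent p (k0 k : 'I_m) : \bar R :=
  if (k <= k0)%N then (1 - tail_sum p k)^-1 else 2.

End Exponents.

(* Main.v *)
Require Import Defs.
From HB Require Import structures.
From mathcomp Require Import all_boot all_order all_algebra.
From mathcomp Require Import complex.
From mathcomp Require Import all_classical all_reals all_analysis.
From mathcomp Require Import ring lra.

Set Implicit Arguments.
Unset Strict Implicit.
Unset Printing Implicit Defensive.

Import Order.TTheory GRing.Theory Num.Theory.

Local Open Scope ring_scope.

(** Write [T_k] for the tail sum [1/p_k + ... + 1/p_m], so that
    [1/s_k = min (1/2, 1 - T_k)].

    The inequality.  For vectors [x_k] of the unit balls and signs, the numbers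
    [c_j = A(e_j) x_1(j_1) ... x_m(j_m)] are the coefficients of a decoupled
    Rademacher chaos bounded by the norm of [A].  Khinchine's inequality for
    such chaoses, with constants coming from the fourth moment, shows that for
    every position [i] the sum over [j_i] of the [l_2] norm of [c] in the
    remaining indices is at most a constant times the norm of [A]
    ([chaos_mixed_bound], [weighted_coef_bound]).  It remains to choose the
    [x_k] well.  Where the iterated norm [N] is computed, each successive norm
    distributes a unit of mass over its index, which yields a probability [P]
    on multi-indices such that [A(e_j)] is, in modulus, [N] times the product
    of the conditional probabilities of the [j_k] given their predecessors,
    raised to the powers [1/s_k] ([mixed_norm_weights]).  With [P_k] the [k]-th
    marginal of [P], take [x_k = P_k ^ (1/p_k)].  By Cauchy-Schwarz, the bound
    at position [i] controls the [P]-mean of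
    [g_i = |c_j| / sqrt (P(j) P_i(j_i))].  A suitable weighted geometric mean
    of the [g_i] is at least [N] on the support of [P]: the powers of the
    conditional probabilities regroup into powers of the probabilities of the
    prefixes [(j_1, ..., j_l)], and a prefix is at most as likely as its last
    index.
    The arithmetic-geometric inequality concludes
    ([mixed_norm_le_of_marginals]).  All the exponents are treated at once,
    including the infinite one.

    Optimality up to [k0].  Summing the products [z_k(i) ... z_m(i)] over [i]
    gives a form of norm at most [n ^ (1 - T_k)] and iterated norm at least
    [n ^ (1/t_k)] ([rinv_le_of_admissible]).

    Sharpness beyond [k0].  Restrict a random sign tensor to the positions from
    [k0] on, where all the [p_l] are at least 2.  By a union bound, its value on
    any sign vectors, with arbitrary supports, is at most of the order of
    [sqrt n] times the product of their Euclidean norms ([exists_sign_tensor]);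
    the same holds for all vectors up to powers of [log n]
    ([multilinear_le_of_ternary]).  Comparing the powers of [n] on both sides
    of the inequality shows that an exponent 2 cannot be lowered
    ([not_admissible_lower]).  Positions are numbered from 1 here and from 0
    below. *)

(** * Sums over functions on a finite ordinal *)

Definition fcons (T : finType) (m : nat) (t : T) (g : {ffun 'I_m -> T}) :
    {ffun 'I_m.+1 -> T} :=
  [ffun k => if unlift ord0 k is Some k' then g k' else t].

Lemma fcons0 (T : finType) (m : nat) (t : T) (g : {ffun 'I_m -> T}) :
  fcons t g ord0 = t.
Proof. by rewrite ffunE unlift_none. Qed.

Lemma fconsS (T : finType) (m : nat) (t : T) (g : {ffun 'I_m -> T}) k :
  fcons t g (lift ord0 k) = g k.
Proof. by rewrite ffunE liftK. Qed.

Lemma sum_fcons (V : nmodType) (T : finType) (m : nat)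
    (F : {ffun 'I_m.+1 -> T} -> V) :
  \sum_f F f = \sum_t \sum_g F (fcons t g).
Proof.
rewrite pair_big /=.
rewrite (reindex (fun p : T * {ffun 'I_m -> T} => fcons p.1 p.2)) //=.
exists (fun f : {ffun 'I_m.+1 -> T} => (f ord0, [ffun k => f (lift ord0 k)])).
  move=> [t g] _ /=; rewrite fcons0; congr pair; apply/ffunP => k.
  by rewrite ffunE fconsS.
move=> f _ /=; apply/ffunP => k.
by rewrite ffunE; case: unliftP => [k'|] -> //; rewrite ffunE.
Qed.

Lemma sum_ffun0 (V : nmodType) (T : finType) (F : {ffun 'I_0 -> T} -> V) f0 :
  \sum_f F f = F f0.
Proof.
have e (f : {ffun 'I_0 -> T}) : f = f0 by apply/ffunP => -[].
by rewrite (big_pred1 f0) // => f /=; rewrite (e f) eqxx.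
Qed.

Lemma sum_cauchy_schwarz (R : realDomainType) (I : finType) (P : pred I)
    (a b : I -> R) :
  (\sum_(i | P i) a i * b i) ^+ 2 <=
  (\sum_(i | P i) a i ^+ 2) * (\sum_(i | P i) b i ^+ 2).
Proof.
have h : 0 <= \sum_(i | P i) \sum_(j | P j) (a i * b j - a j * b i) ^+ 2.
  by apply: sumr_ge0 => i _; apply: sumr_ge0 => j _; exact: sqr_ge0.
have e : \sum_(i | P i) \sum_(j | P j) (a i * b j - a j * b i) ^+ 2 =
    2 * ((\sum_(i | P i) a i ^+ 2) * (\sum_(i | P i) b i ^+ 2)
         - (\sum_(i | P i) a i * b i) ^+ 2).
  have -> : \sum_(i | P i) \sum_(j | P j) (a i * b j - a j * b i) ^+ 2 =
     \sum_(i | P i) \sum_(j | P j) (a i ^+ 2 * b j ^+ 2) +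
     \sum_(i | P i) \sum_(j | P j) (b i ^+ 2 * a j ^+ 2) -
     2 * \sum_(i | P i) \sum_(j | P j) (a i * b i) * (a j * b j).
    rewrite mulr_sumr -big_split -sumrB; apply: eq_bigr => i _.
    rewrite mulr_sumr -big_split -sumrB; apply: eq_bigr => j _ /=; ring.
  rewrite -!big_distrlr /=; ring.
by rewrite -subr_ge0; move: h; rewrite e pmulr_rge0.
Qed.

(** * Khinchine's inequality for decoupled Rademacher chaos *)

Definition mean (R : realFieldType) (T : finType) (f : T -> R) : R :=
  #|T|%:R^-1 * \sum_t f t.

Section Mean.
Variables (R : realFieldType) (T : finType).
Implicit Types f g : T -> R.

Lemma eq_mean f g : f =1 g -> mean f = mean g.
Proof. by move=> fg; congr (_ * _); apply: eq_bigr. Qed.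

Lemma meanD f g : mean (fun t => f t + g t) = mean f + mean g.
Proof. by rewrite /mean big_split mulrDr. Qed.

Lemma meanZ (c : R) f : mean (fun t => c * f t) = c * mean f.
Proof. by rewrite /mean -mulr_sumr mulrCA. Qed.

Lemma mean_sum (I : finType) (F : I -> T -> R) :
  mean (fun t => \sum_i F i t) = \sum_i mean (F i).
Proof. by rewrite /mean exchange_big /= mulr_sumr. Qed.

Lemma mean_cst (c : R) : (0 < #|T|)%N -> mean (fun _ : T => c) = c.
Proof.
move=> T0; rewrite /mean sumr_const -[c *+ _]mulr_natr mulrCA mulVf ?mulr1 //.
by rewrite pnatr_eq0 -lt0n.
Qed.

Lemma ler_mean f g : (forall t, f t <= g t) -> mean f <= mean g.
Proof.
move=> fg; apply: ler_wpM2l; first by rewrite invr_ge0.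
by apply: ler_sum => t _.
Qed.

Lemma mean_ge0 f : (forall t, 0 <= f t) -> 0 <= mean f.
Proof. by move=> f0; rewrite mulr_ge0 ?invr_ge0 // sumr_ge0. Qed.

Lemma mean_cauchy_schwarz f g :
  mean (fun t => f t * g t) ^+ 2 <=
  mean (fun t => f t ^+ 2) * mean (fun t => g t ^+ 2).
Proof.
rewrite /mean exprMn [leRHS]mulrACA -expr2.
by apply: ler_wpM2l; rewrite ?sqr_ge0 // sum_cauchy_schwarz.
Qed.

End Mean.

Lemma mean_exchange (R : realFieldType) (S T : finType) (F : S -> T -> R) :
  mean (fun s => mean (F s)) = mean (fun t => mean (F^~ t)).
Proof.
by rewrite /mean -!mulr_sumr exchange_big /= mulrCA.
Qed.

Lemma mean_fcons (R : realFieldType) (T : finType) (m : nat)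
    (F : {ffun 'I_m.+1 -> T} -> R) :
  mean F = mean (fun t => mean (fun g => F (fcons t g))).
Proof.
rewrite /mean sum_fcons -mulr_sumr mulrA; congr (_ * _).
by rewrite !card_ffun !card_ord expnS natrM invfM.
Qed.

Lemma mean_ffun0 (R : realFieldType) (T : finType)
    (F : {ffun 'I_0 -> T} -> R) f0 : mean F = F f0.
Proof. by rewrite /mean (sum_ffun0 _ f0) card_ffun card_ord expn0 invr1 mul1r. Qed.

Definition sgn (R : pzRingType) (b : bool) : R := (-1) ^+ b.

Lemma mean_bool (R : realFieldType) (F : bool -> R) :
  mean F = 2^-1 * (F true + F false).
Proof. by rewrite /mean card_bool big_bool. Qed.

Definition rademacher (R : pzRingType) (n : nat) (a : 'I_n -> R)
    (s : {ffun 'I_n -> bool}) : R := \sum_i sgn R (s i) * a i.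

Lemma rademacher_fcons (R : pzRingType) (n : nat) (a : 'I_n.+1 -> R) b g :
  rademacher a (fcons b g) =
  sgn R b * a ord0 + rademacher (fun i => a (lift ord0 i)) g.
Proof.
rewrite /rademacher big_ord_recl fcons0; congr (_ + _).
by apply: eq_bigr => k _; rewrite fconsS.
Qed.

Lemma card_signs_gt0 (n : nat) : (0 < #|{ffun 'I_n -> bool}|)%N.
Proof. by rewrite card_ffun card_bool expn_gt0. Qed.

Lemma rademacher_moment2 (R : realFieldType) (n : nat) (a : 'I_n -> R) :
  mean (fun s => rademacher a s ^+ 2) = \sum_i a i ^+ 2.
Proof.
elim: n a => [|n IH] a.
  rewrite (mean_ffun0 _ [ffun i => false]) /rademacher !big_ord0.
  by rewrite expr0n.
rewrite mean_fcons mean_bool big_ord_recl -IH -meanD.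
rewrite -(@mean_cst R _ (a ord0 ^+ 2) (card_signs_gt0 n)) -meanD -meanZ.
apply: eq_mean => g; rewrite !rademacher_fcons /sgn expr1 expr0; by field.
Qed.

Lemma rademacher_moment4 (R : realFieldType) (n : nat) (a : 'I_n -> R) :
  mean (fun s => rademacher a s ^+ 4) <= 3 * (\sum_i a i ^+ 2) ^+ 2.
Proof.
elim: n a => [|n IH] a.
  rewrite (mean_ffun0 _ [ffun i => false]) /rademacher !big_ord0.
  by rewrite !expr0n mulr0.
rewrite mean_fcons mean_bool big_ord_recl -meanD -meanZ.
set a' := fun i => a (lift ord0 i).
have := IH a'; rewrite -/(a' _) -(rademacher_moment2 a').
set M2 := mean _; set M4 := mean _ => h.
rewrite (@eq_mean _ _ _ (fun g => a ord0 ^+ 4 +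
   (6 * a ord0 ^+ 2 * rademacher a' g ^+ 2 + rademacher a' g ^+ 4))); last first.
  by move=> g; rewrite !rademacher_fcons /sgn expr1 expr0 -/a'; by field.
rewrite meanD meanD meanZ mean_cst ?card_signs_gt0 // -/M2 -/M4.
have : 0 <= a ord0 ^+ 4 by rewrite -[4%N]/(2 * 2)%N exprM sqr_ge0.
nra.
Qed.

(** This is a decoupled Rademacher chaos: when [s] is uniformly distributed, the
    families of signs attached to different positions are independent. *)
Definition chaos (R : comPzRingType) (m n : nat) (c : {ffun 'I_m -> 'I_n} -> R)
    (s : {ffun 'I_m -> {ffun 'I_n -> bool}}) : R :=
  \sum_j c j * \prod_k sgn R (s k (j k)).

Lemma chaos_fcons (R : comPzRingType) (m n : nat)
    (c : {ffun 'I_m.+1 -> 'I_n} -> R) t s :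
  chaos c (fcons t s) = rademacher (fun i => chaos (fun j => c (fcons i j)) s) t.
Proof.
rewrite /chaos /rademacher sum_fcons; apply: eq_bigr => i _.
rewrite mulr_sumr; apply: eq_bigr => j _.
rewrite big_ord_recl !fcons0 mulrCA; congr (_ * (_ * _)).
by apply: eq_bigr => k _; rewrite !fconsS.
Qed.

Lemma chaos0 (R : comPzRingType) (n : nat) (c : {ffun 'I_0 -> 'I_n} -> R) s j :
  chaos c s = c j.
Proof. by rewrite /chaos (sum_ffun0 _ j) big_ord0 mulr1. Qed.

Lemma chaos_moment2 (R : realFieldType) (m n : nat)
    (c : {ffun 'I_m -> 'I_n} -> R) :
  mean (fun s => chaos c s ^+ 2) = \sum_j c j ^+ 2.
Proof.
elim: m c => [|m IH] c.
  have j : {ffun 'I_0 -> 'I_n} by apply: finfun => -[].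
  by rewrite (mean_ffun0 _ [ffun => [ffun => false]]) (sum_ffun0 _ j) (chaos0 _ _ j).
rewrite mean_fcons mean_exchange sum_fcons.
under eq_mean => s.
  under eq_mean => t do rewrite chaos_fcons.
  rewrite rademacher_moment2; over.
by rewrite mean_sum; under eq_bigr do rewrite IH.
Qed.

(** Conditioning on all but the first family of signs gives a Rademacher sum,
    whose fourth moment is at most three times its squared variance; the
    variance is a sum of squares of chaoses of lower order, and its square is
    controlled by Cauchy-Schwarz. *)
Lemma chaos_moment4 (R : realFieldType) (m n : nat)
    (c : {ffun 'I_m -> 'I_n} -> R) :
  mean (fun s => chaos c s ^+ 4) <= 3 ^+ m * (\sum_j c j ^+ 2) ^+ 2.
Proof.
elim: m c => [|m IH] c.
  have j : {ffun 'I_0 -> 'I_n} by apply: finfun => -[].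
  rewrite (mean_ffun0 _ [ffun => [ffun => false]]) (sum_ffun0 _ j) (chaos0 _ _ j).
  by rewrite mul1r -exprM.
rewrite mean_fcons mean_exchange sum_fcons.
pose y i s := chaos (fun j => c (fcons i j)) s.
pose S i : R := \sum_j c (fcons i j) ^+ 2.
have S0 i : 0 <= S i by apply: sumr_ge0 => j _; exact: sqr_ge0.
rewrite -/(S _).
apply: (@le_trans _ _ (mean (fun s => 3 * \sum_i \sum_i' y i s ^+ 2 * y i' s ^+ 2))).
  apply: ler_mean => s.
  under eq_mean => t do rewrite chaos_fcons.
  by apply: le_trans (rademacher_moment4 _) _; rewrite expr2 big_distrlr.
rewrite meanZ exprS -mulrA ler_wpM2l // expr2 big_distrlr mulr_sumr mean_sum.
apply: ler_sum => i _; rewrite mean_sum mulr_sumr; apply: ler_sum => i' _.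
have y0 k k' : 0 <= mean (fun s => y k s ^+ 2 * y k' s ^+ 2).
  by apply: mean_ge0 => s; rewrite mulr_ge0 // sqr_ge0.
have H0 : 0 <= 3 ^+ m * (S i * S i') :> R by rewrite !mulr_ge0 // exprn_ge0.
rewrite -(ler_pXn2r (n := 2)) ?nnegrE //.
apply: le_trans (mean_cauchy_schwarz _ _) _.
have -> : (3 ^+ m * (S i * S i')) ^+ 2 =
    (3 ^+ m * S i ^+ 2) * (3 ^+ m * S i' ^+ 2) by ring.
apply: ler_pM; do 1?by apply: mean_ge0 => s; rewrite sqr_ge0.
- by under eq_mean do rewrite -exprM; exact: IH.
- by under eq_mean do rewrite -exprM; exact: IH.
Qed.

(** The first moment is recovered from the second and the fourth by integrating
    the polynomial inequality [3 u^2 <= 2 u + u^4], valid for [0 <= u], after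
    normalising the chaos by [sqrt (3^m S)]. *)
Lemma chaos_khinchine (R : realType) (m n : nat)
    (c : {ffun 'I_m -> 'I_n} -> R) :
  Num.sqrt (\sum_j c j ^+ 2) <=
  Num.sqrt (3 ^+ m) * mean (fun s => `|chaos c s|).
Proof.
set S := \sum_j _; have S0 : 0 <= S by apply: sumr_ge0 => j _; exact: sqr_ge0.
have m0 : 0 <= mean (fun s => `|chaos c s|) by exact: mean_ge0.
have t0 : (0 : R) < 3 ^+ m by rewrite exprn_gt0.
have [->|Sn0] := eqVneq S 0; first by rewrite sqrtr0 mulr_ge0 ?sqrtr_ge0.
have {}S0 : 0 < S by rewrite lt_def Sn0.
pose L := Num.sqrt (3 ^+ m * S).
have L2 : L ^+ 2 = 3 ^+ m * S by rewrite sqr_sqrtr // mulr_ge0 // ltW.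
have L0 : 0 < L by rewrite sqrtr_gt0 mulr_gt0.
have h : 3 * L ^+ 2 * mean (fun s => chaos c s ^+ 2) <=
         2 * L ^+ 3 * mean (fun s => `|chaos c s|) + mean (fun s => chaos c s ^+ 4).
  rewrite -!meanZ -meanD; apply: ler_mean => s.
  set x := chaos c s; rewrite -(@real_normK _ x) ?num_real //.
  rewrite (_ : x ^+ 4 = `|x| ^+ 4); last first.
    by rewrite -[4%N]/(2 * 2)%N !exprM real_normK ?num_real.
  have : 0 <= `|x| by []. move: `|x| => u u0.
  rewrite -subr_ge0 (_ : _ - _ = u * (u - L) ^+ 2 * (u + 2 * L)); last by ring.
  apply: mulr_ge0; first by apply: mulr_ge0; rewrite ?sqr_ge0.
  by rewrite addr_ge0 // mulr_ge0 // ltW.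
have := chaos_moment4 c; rewrite -/S; move: h; rewrite chaos_moment2 -/S.
move: (mean (fun s => chaos c s ^+ 4)) => M4 h1 h2.
move: m0 h1; move: (mean _) => M1 m0 h1.
have h3 : 2 * (3 ^+ m * S ^+ 2) <= 2 * L ^+ 3 * M1.
  move: h1; rewrite L2; move: h2; nra.
have h4 : S <= L * M1.
  rewrite -(@ler_pM2l _ (2 * (3 ^+ m * S))) ?mulr_gt0 //.
  by move: h3; rewrite (exprS L 2) L2; lra.
rewrite -(@ler_pM2r _ (Num.sqrt S)) ?sqrtr_gt0 // -expr2 sqr_sqrtr ?(ltW S0) //.
by rewrite mulrAC -sqrtrM ?(ltW t0).
Qed.

(** Splitting the chaos according to the value [a] of the index at position [i]
    and choosing the signs of that position so that all the pieces add up, the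
    uniform bound [B] controls the sum over [a] of their absolute values; each
    piece is bounded below on average by its [l_2] norm. *)
Lemma chaos_mixed_bound (R : realType) (m n : nat)
    (c : {ffun 'I_m -> 'I_n} -> R) (B : R) (i : 'I_m) :
  (forall s, `|chaos c s| <= B) ->
  \sum_a Num.sqrt (\sum_(j : {ffun 'I_m -> 'I_n} | j i == a) c j ^+ 2) <=
  Num.sqrt (3 ^+ m) * B.
Proof.
move=> cB.
pose ca a (j : {ffun 'I_m -> 'I_n}) : R := if j i == a then c j else 0.
have pieces s : \sum_a `|chaos (ca a) s| <= B.
  pose s' := [ffun k => [ffun a => (s k a) (+) ((k == i) && (chaos (ca a) s < 0))]].
  have flip a : chaos (ca a) s' = `|chaos (ca a) s|.
    rewrite normrEsign /chaos mulr_sumr; apply: eq_bigr => j _.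
    rewrite /ca; case: eqP => [ji|]; last by rewrite !mul0r mulr0.
    rewrite mulrCA; congr (_ * _).
    rewrite (bigD1 i) //= [in RHS](bigD1 i) //= mulrA; congr (_ * _).
      by rewrite !ffunE eqxx /= ji /sgn signr_addb mulrC.
    by apply: eq_bigr => k /negbTE ki; rewrite !ffunE ki addbF.
  have -> : \sum_a `|chaos (ca a) s| = chaos c s'.
    under eq_bigr do rewrite -flip.
    rewrite /chaos exchange_big /=; apply: eq_bigr => j _.
    rewrite -mulr_suml; congr (_ * _).
    rewrite (bigD1 (j i)) //= /ca eqxx big1 ?addr0 // => a.
    by rewrite eq_sym => /negbTE ->.
  exact: le_trans (ler_norm _) (cB _).
apply: (@le_trans _ _
  (\sum_a Num.sqrt (3 ^+ m) * mean (fun s => `|chaos (ca a) s|))).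
  apply: ler_sum => a _; apply: le_trans (chaos_khinchine (ca a)).
  rewrite big_mkcond /= le_eqVlt; apply/orP; left; apply/eqP.
  congr Num.sqrt; apply: eq_bigr => j _; rewrite /ca.
  by case: ifP => //; rewrite expr0n.
rewrite -mulr_sumr -mean_sum ler_wpM2l ?sqrtr_ge0 //.
rewrite -(@mean_cst R {ffun 'I_m -> {ffun 'I_n -> bool}} B).
  exact: ler_mean.
by rewrite card_ffun expn_gt0 card_signs_gt0.
Qed.

(** * Extremal weights for iterated norms *)

Definition rinv (R : realType) (q : \bar R) : R := fine (q^-1)%E.

Lemma rinvE (R : realType) (r : R) : 0 < r -> rinv r%:E = r^-1.
Proof. by move=> r0; rewrite /rinv inver gt_eqF. Qed.

Lemma rinvy (R : realType) : rinv (+oo%E : \bar R) = 0.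
Proof. by rewrite /rinv invey. Qed.

Section Lnorm.
Variables (R : realType) (n : nat).
Implicit Types (q : \bar R) (a : 'I_n -> R).

Lemma lnorm_ge0 q a : 0 <= lnorm q a.
Proof.
rewrite /lnorm; case: q => [r||]; first exact: powR_ge0.
  by rewrite bigmax_idl le_max lexx.
by rewrite bigmax_idl le_max lexx.
Qed.

Lemma lnormE r a : 0 < r -> lnorm r%:E a `^ r = \sum_i `|a i| `^ r.
Proof.
move=> r0; rewrite /lnorm -powRrM mulVf ?gt_eqF // powRr1 //.
by apply: sumr_ge0 => i _; exact: powR_ge0.
Qed.

(** For finite [q] the weights are [(a_i / N)^q], where [N] is the norm; for
    [q = +oo] they form the Dirac mass at an index where the maximum is
    attained. *)
Lemma lnorm_weights q a : (0 < q)%E -> (forall i, 0 <= a i) -> 0 < lnorm q a ->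
  exists w : 'I_n -> R, [/\ forall i, 0 <= w i, \sum_i w i = 1 &
    forall i, 0 < w i -> a i = lnorm q a * expR (rinv q * ln (w i))].
Proof.
move=> q0 a0 N0; case: q q0 N0 => [r||] q0 N0 //.
- rewrite lte_fin in q0; set N := lnorm _ _ in N0 *.
  exists (fun i => (a i / N) `^ r); split.
  + by move=> i; exact: powR_ge0.
  + under eq_bigr => i _ do rewrite powRM ?invr_ge0 ?(ltW N0) // -powR_inv1 ?(ltW N0) //
      powRAC.
    rewrite -mulr_suml (eq_bigr (fun i => `|a i| `^ r)); last first.
      by move=> i _; rewrite ger0_norm.
    rewrite -lnormE // -/N powR_inv1 ?powR_ge0 // divff //.
    by rewrite gt_eqF // powR_gt0.
  + move=> i w0; have aN : 0 < a i / N.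
      by apply: gt0_powR w0 => //; rewrite divr_ge0 // ltW.
    rewrite ln_powR rinvE // mulKf ?gt_eqF // lnK ?posrE //.
    by rewrite mulrC divfK // gt_eqF.
- have [i0 i0N] : exists i0, lnorm +oo a = a i0.
    have j : 'I_n.
      case: (posnP n) N0 => [n0|n0 _]; last exact: (Ordinal n0).
      rewrite /lnorm /= bigmax_eq_id ?ltxx // => i.
      by have := leq_trans (ltn_ord i) (eq_leq n0).
    have [|i _ e] := @eq_bigmax _ _ _ 0 j predT (fun i => `|a i|) isT.
      by move=> i _; exact: normr_ge0.
    by exists i; rewrite /lnorm e ger0_norm.
  exists (fun i => (i == i0)%:R); split.
  + by move=> i; rewrite ler0n.
  + by rewrite (bigD1 i0) //= eqxx big1 ?addr0 // => i /negbTE ->.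
  + move=> i; case: eqP => [->|]; last by rewrite ltxx.
    by rewrite ln1 mulr0 expR0 mulr1.
Qed.

End Lnorm.


Lemma rinv_ge0 (R : realType) (q : \bar R) : (0 <= q)%E -> 0 <= rinv q.
Proof.
case: q => [r||] //.
by rewrite lee_fin /rinv inver; case: eqP => //= _; rewrite invr_ge0.
Qed.

Lemma ord_consE (m n : nat) (i : 'I_n) (j : {ffun 'I_m -> 'I_n}) :
  ord_cons i j = fcons i j :> ('I_m.+1 -> 'I_n).
Proof. by apply: funext => k; rewrite /ord_cons ffunE. Qed.

Definition ftail (T : finType) (m : nat) (f : {ffun 'I_m.+1 -> T}) :
  {ffun 'I_m -> T} := [ffun k => f (lift ord0 k)].

Lemma fcons_ftail (T : finType) (m : nat) (f : {ffun 'I_m.+1 -> T}) :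
  fcons (f ord0) (ftail f) = f.
Proof.
by apply/ffunP => k; rewrite ffunE; case: unliftP => [k'|] -> //; rewrite ffunE.
Qed.

Lemma ftail_fcons (T : finType) (m : nat) t (g : {ffun 'I_m -> T}) :
  ftail (fcons t g) = g.
Proof. by apply/ffunP => k; rewrite ffunE fconsS. Qed.

Lemma mixed_norm_ge0 (R : realType) (n m : nat) (t : 'I_m -> \bar R)
    (a : ('I_m -> 'I_n) -> R) : (forall j, 0 <= a j) -> 0 <= mixed_norm t a.
Proof. by case: m t a => [|m] t a a0 /=; [exact: a0|exact: lnorm_ge0]. Qed.

(** The weights of the outermost norm are the law of the first index, and the
    weights obtained by induction for each slice are the law of the other
    indices given the first one; [expR (- U k j)] is the conditional probability
    of [j k] given the previous indices.  The last inequality holds because the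
    event that the indices up to [k] are those of [j] is contained in the event
    that the index at [k] is [j k]. *)
Lemma mixed_norm_weights (R : realType) (n m : nat) (t : 'I_m -> \bar R)
    (a : ('I_m -> 'I_n) -> R) :
  (forall k, 0 < t k)%E -> (forall j, 0 <= a j) -> 0 < mixed_norm t a ->
  exists (P : {ffun 'I_m -> 'I_n} -> R) (U : 'I_m -> {ffun 'I_m -> 'I_n} -> R),
  [/\ forall j, 0 <= P j, \sum_j P j = 1 & forall j, 0 < P j ->
    [/\ P j = expR (- \sum_k U k j),
        a j = mixed_norm t a * expR (- \sum_k rinv (t k) * U k j),
        forall k, 0 <= U k j &
        forall k : 'I_m, expR (- \sum_(l < m | (l <= k)%N) U l j) <=
                  \sum_(j' : {ffun 'I_m -> 'I_n} | j' k == j k) P j']].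
Proof.
elim: m t a => [|m IH] t a t0 a0 N0.
  exists (fun=> 1), (fun _ _ => 0); split=> //.
    have j : {ffun 'I_0 -> 'I_n} by apply: finfun => -[].
    by rewrite (sum_ffun0 _ j).
  move=> j _; rewrite !big_ord0 oppr0 expR0 mulr1; split=> //; last by case.
  by congr a; apply: funext => -[].
set b := fun i : 'I_n => mixed_norm (fun k : 'I_m => t (lift ord0 k))
                   (fun j => a (ord_cons i j)).
have b0 i : 0 <= b i by apply: mixed_norm_ge0 => j; exact: a0.
have [w [w0 w1 wb]] := lnorm_weights (t0 ord0) b0 N0.
have /boolp.choice [P /boolp.choice [U PU]] : forall i,
    exists (P : {ffun 'I_m -> 'I_n} -> R) (U : 'I_m -> {ffun 'I_m -> 'I_n} -> R),
  0 < w i ->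
  [/\ forall j, 0 <= P j, \sum_j P j = 1 & forall j, 0 < P j ->
    [/\ P j = expR (- \sum_k U k j),
        a (ord_cons i j) = b i * expR (- \sum_k rinv (t (lift ord0 k)) * U k j),
        forall k, 0 <= U k j &
        forall k : 'I_m, expR (- \sum_(l < m | (l <= k)%N) U l j) <=
                  \sum_(j' : {ffun 'I_m -> 'I_n} | j' k == j k) P j']].
  move=> i; case: (ltrP 0 (w i)) => wi; last by exists (fun=> 0), (fun _ _ => 0).
  have [|||P [U PU]] := IH (fun k => t (lift ord0 k)) (fun j => a (ord_cons i j)).
  - by move=> k; exact: t0.
  - by move=> j; exact: a0.
  - by rewrite -/(b i) wb // mulr_gt0 // expR_gt0.
  by exists P, U.
(* An index of weight zero carries no mass, so [P i] is arbitrary there. *)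
have wP i j : 0 <= w i * P i j.
  have [wi|wi] := ltrP 0 (w i); first by rewrite mulr_ge0 //; case: (PU i wi).
  by rewrite (_ : w i = 0) ?mul0r //; apply/eqP; rewrite eq_le wi w0.
exists (fun j : {ffun 'I_m.+1 -> 'I_n} => w (j ord0) * P (j ord0) (ftail j)).
exists (fun k (j : {ffun 'I_m.+1 -> 'I_n}) =>
  if unlift ord0 k is Some k' then U (j ord0) k' (ftail j)
  else - ln (w (j ord0))).
split.
- by move=> j; exact: wP.
- rewrite sum_fcons -w1; apply: eq_bigr => i _.
  under eq_bigr do rewrite fcons0 ftail_fcons.
  rewrite -mulr_sumr; have [wi|wi] := ltrP 0 (w i).
    by case: (PU i wi) => _ -> _; rewrite mulr1.
  by rewrite (_ : w i = 0) ?mul0r //; apply/eqP; rewrite eq_le wi w0.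
- move=> j; rewrite -[in a j](fcons_ftail j) -ord_consE.
  set i := j ord0; set g := ftail j => wPj.
  have wi : 0 < w i.
    by rewrite lt_def w0 andbT; apply: contraTneq wPj => ->; rewrite mul0r ltxx.
  have Pj : 0 < P i g by move: wPj; rewrite pmulr_rgt0.
  have lw : w i = expR (- - ln (w i)) by rewrite opprK lnK.
  have lw0 : 0 <= - ln (w i).
    rewrite oppr_ge0 ln_le0 // -w1 (bigD1 i) //= lerDl.
    by apply: sumr_ge0 => k _; exact: w0.
  have [_ _ /(_ _ Pj) [Pg ag U0 marg]] := PU i wi.
  split.
  + rewrite big_ord_recl unlift_none opprD expRD -lw Pg; congr (_ * expR (- _)).
    by apply: eq_bigr => k _; rewrite liftK.
  + rewrite big_ord_recl unlift_none ag wb //.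
    rewrite mulrN opprD opprK expRD mulrA; congr (_ * expR (- _)).
    by apply: eq_bigr => k _; rewrite liftK.
  + by move=> k; case: unliftP.
  + move=> k; rewrite big_mkcond big_ord_recl /= unlift_none opprD expRD -lw.
    rewrite [leRHS]big_mkcond sum_fcons (bigD1 i) //=.
    apply: le_trans (_ : _ <= \sum_(g' : {ffun 'I_m -> 'I_n})
        if fcons i g' k == j k then w i * P i g' else 0) _; last first.
      under eq_bigr do rewrite fcons0 ftail_fcons.
      rewrite lerDl; apply: sumr_ge0 => i' _; apply: sumr_ge0 => g' _.
      by case: ifP => // _; rewrite fcons0 ftail_fcons.
    case: (unliftP ord0 k) => [k'|] ->.
      under [leRHS]eq_bigr do rewrite fconsS.
      rewrite -[leRHS]big_mkcond -mulr_sumr ler_pM2l //.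
      apply: le_trans (le_trans (marg k') _).
        rewrite [X in _ <= expR (- X)]big_mkcond.
        rewrite (eq_bigr (fun l : 'I_m => if (l <= k')%N then U i l g else 0)) //.
        by move=> l _; rewrite liftK.
      by rewrite /g ffunE.
    under [leRHS]eq_bigr do rewrite fcons0 eqxx.
    rewrite -mulr_sumr; case: (PU i wi) => _ -> _.
    rewrite big1 ?oppr0 ?expR0 // => l _.
Qed.

(** * From coordinatewise bounds to the iterated norm *)

(** The graph of [expR] lies above its tangent at the mean of the [y i]. *)
Lemma expR_jensen (R : realType) (I : finType) (th y : I -> R) :
  (forall i, 0 <= th i) -> \sum_i th i = 1 ->
  expR (\sum_i th i * y i) <= \sum_i th i * expR (y i).
Proof.
move=> th0 th1; set Y := \sum_i _.
have tangent i : th i * (expR Y * (1 + (y i - Y))) <= th i * expR (y i).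
  apply: ler_wpM2l => //.
  have -> : expR (y i) = expR Y * expR (y i - Y) by rewrite -expRD addrC subrK.
  rewrite ler_wpM2l ?expR_ge0 //.
  by rewrite expR_ge1Dx.
apply: le_trans (ler_sum _ (fun i _ => tangent i)).
under eq_bigr do rewrite mulrCA mulrDr mulr1 mulrBr.
by rewrite -mulr_sumr big_split sumrB -mulr_suml /= th1 -/Y mul1r subrr addr0 mulr1.
Qed.

Section EntropyBound.
Variables (R : realType) (m n : nat).
Local Notation J := {ffun 'I_m -> 'I_n}.
Variables (t : 'I_m -> \bar R) (tau c : 'I_m -> R) (a : ('I_m -> 'I_n) -> R).
Variable B : R.
Hypothesis t0 : forall k, (0 < t k)%E.
Hypothesis a0 : forall j, 0 <= a j.
Hypothesis B0 : 0 <= B.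
Hypothesis c0 : forall k, 0 <= c k.
Hypothesis ctau : forall k, c k <= tau k.
Hypothesis tc1 : \sum_k 2 * (tau k - c k) = 1.
Hypothesis tE : forall k : 'I_m, 2^-1 - rinv (t k) = \sum_(l < m | (k <= l)%N) c l.
Hypothesis aB : forall w : 'I_m -> 'I_n -> R,
  (forall k i, 0 <= w k i) -> (forall k, \sum_i w k i = 1) ->
  forall i, \sum_b Num.sqrt (\sum_(j : J | j i == b)
    (a j * \prod_k w k (j k) `^ tau k) ^+ 2) <= B.

(** This is where the exponents are used: the coefficient of [U k] is the sum of
    the [c l] for [l >= k], so exchanging the sums pairs each [c l] with the
    nonnegative difference between the sum of the [U k], [k <= l], and [L l];
    everything else cancels because the weights [2 * (tau i - c i)] add up
    to 1. *)
Lemma entropy_exponent (U L : 'I_m -> R) :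
  (forall l : 'I_m, L l <= \sum_(k < m | (k <= l)%N) U k) ->
  0 <= \sum_i (2 * (tau i - c i)) *
    (\sum_k (2^-1 - rinv (t k)) * U k - \sum_k tau k * L k + 2^-1 * L i).
Proof.
move=> LU.
have -> : \sum_k (2^-1 - rinv (t k)) * U k =
    \sum_l c l * \sum_(k < m | (k <= l)%N) U k.
  under eq_bigr do rewrite tE mulr_suml big_mkcond.
  rewrite exchange_big /=; apply: eq_bigr => l _.
  by rewrite mulr_sumr [RHS]big_mkcond.
rewrite (eq_bigr (fun i => (2 * (tau i - c i)) *
   (\sum_l c l * \sum_(k < m | (k <= l)%N) U k - \sum_k tau k * L k) +
   (tau i * L i - c i * L i))); last by move=> i _; field.
rewrite big_split sumrB -mulr_suml /= tc1 mul1r addrA subrK -sumrB.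
by apply: sumr_ge0 => l _; rewrite -mulrBr mulr_ge0 // subr_ge0.
Qed.

(** The argument is an entropy computation in disguise.  Take the probability
    [P] attached to the iterated norm, with marginals [w k], and test the
    hypothesis on [w k `^ tau k].  By Cauchy-Schwarz, the left-hand side at
    position [i] is at least the [P]-expectation of [g i], where
    [g i j = c j / sqrt (P j * w i (j i))] and [c j] is the weighted
    coefficient.  The weighted arithmetic-geometric inequality, applied
    pointwise with weights [2 * (tau i - c i)], bounds an average of the [g i]
    below by the iterated norm. *)
Lemma mixed_norm_le_of_marginals : mixed_norm t a <= B.
Proof.
have [N0|] := ltrP 0 (mixed_norm t a); last by move/le_trans; apply.
set N := mixed_norm t a in N0 *.
have [P [U [P0 P1 PU]]] := mixed_norm_weights t0 a0 N0; rewrite -/N in PU.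
pose w k i := \sum_(j : J | j k == i) P j.
have w0 k i : 0 <= w k i by exact: sumr_ge0.
have w1 k : \sum_i w k i = 1.
  by rewrite -P1 (partition_big (fun j : J => j k) xpredT).
pose C j := a j * \prod_k w k (j k) `^ tau k.
have C0 j : 0 <= C j.
  by rewrite mulr_ge0 // prodr_ge0 // => k _; exact: powR_ge0.
pose h i (j : J) := Num.sqrt (P j) / Num.sqrt (w i (j i)) * C j.
have h0 i j : 0 <= h i j.
  by rewrite /h mulr_ge0 // mulr_ge0 ?invr_ge0 ?sqrtr_ge0.
pose th i := 2 * (tau i - c i).
have th0 i : 0 <= th i by rewrite /th mulr_ge0 // subr_ge0.
have pointwise j : P j * N <= \sum_i th i * h i j.
  have [Pj|Pj] := ltrP 0 (P j); last first.
    rewrite (_ : P j = 0) ?mul0r; last by apply/eqP; rewrite eq_le Pj P0.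
    by apply: sumr_ge0 => i _; rewrite mulr_ge0 ?th0 ?h0.
  have [PE aE U0 marg] := PU j Pj.
  pose L k := - ln (w k (j k)).
  have wj k : 0 < w k (j k) by exact: lt_le_trans (expR_gt0 _) (marg k).
  have LU (l : 'I_m) : L l <= \sum_(k < m | (k <= l)%N) U k j.
    by rewrite lerNl -ler_expR lnK ?posrE.
  pose y i := \sum_k (2^-1 - rinv (t k)) * U k j - \sum_k tau k * L k + 2^-1 * L i.
  have hE i : h i j = P j * (N * expR (y i)).
    have CE : C j = N * expR (- \sum_k rinv (t k) * U k j - \sum_k tau k * L k).
      rewrite /C aE -mulrA expRD; congr (_ * (_ * _)).
      rewrite -sumrN expR_sum; apply: eq_bigr => k _.
      by rewrite /powR gt_eqF // /L mulrN opprK.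
    have sP : Num.sqrt (P j) = expR (- (2^-1 * \sum_k U k j)).
      by rewrite PE -powR12_sqrt ?expR_ge0 // -expRM mulNr mulrC.
    have sw : Num.sqrt (w i (j i)) = expR (- (2^-1 * L i)).
      rewrite -powR12_sqrt // /powR gt_eqF //; congr expR.
      by rewrite /L mulrN opprK.
    rewrite /h CE sP sw PE -expRN opprK mulrCA [RHS]mulrCA; congr (_ * _).
    rewrite -!expRD; congr expR; rewrite /y.
    have -> : \sum_k (2^-1 - rinv (t k)) * U k j =
        2^-1 * (\sum_k U k j) - \sum_k rinv (t k) * U k j.
      by rewrite mulr_sumr -sumrB; apply: eq_bigr => k _; rewrite mulrBl.
    by field.
  under eq_bigr do rewrite hE mulrCA [X in _ * X]mulrCA.
  rewrite -!mulr_sumr ler_pM2l // ler_peMr ?(ltW N0) //.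
  apply: le_trans (expR_jensen y th0 tc1).
  by rewrite -expR0 ler_expR entropy_exponent.
have slice i : \sum_j h i j <= B.
  have /(_ i) := aB w0 w1; apply: le_trans.
  rewrite (partition_big (fun j : J => j i) xpredT) //=; apply: ler_sum => b _.
  rewrite -(ler_pXn2r (n := 2)) ?nnegrE ?sqrtr_ge0 //; last first.
    by apply: sumr_ge0 => j _; exact: h0.
  rewrite sqr_sqrtr; last by apply: sumr_ge0 => j _; exact: sqr_ge0.
  apply: le_trans (sum_cauchy_schwarz _ _ _) _.
  apply: ler_piMl; first by apply: sumr_ge0 => j _; exact: sqr_ge0.
  rewrite (eq_bigr (fun j => P j * (w i b)^-1)); last first.
    by move=> j /eqP <-; rewrite exprMn exprVn !sqr_sqrtr.
  rewrite -mulr_suml -/(w i b); have [->|wb] := eqVneq (w i b) 0.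
    by rewrite mul0r ler01.
  by rewrite divff.
rewrite -[N]mul1r -P1 mulr_suml.
apply: le_trans (ler_sum _ (fun j _ => pointwise j)) _.
rewrite exchange_big /= -[B]mul1r -tc1 mulr_suml; apply: ler_sum => i _.
by rewrite -mulr_sumr ler_wpM2l // th0.
Qed.

End EntropyBound.

(** * Scalars, multilinear forms and their norms *)

Section Scalars.
Variables (R : realType) (F : scalar_kind).
Local Notation K := (scalars R F).

Definition of_real : R -> K :=
  match F return R -> scalars R F with
  | RealScalars => id
  | ComplexScalars => fun x => (x%:C)%C
  end.

Definition re_part : K -> R :=
  match F return scalars R F -> R with
  | RealScalars => id
  | ComplexScalars => fun z : R[i]%C => complex.Re z
  end.

Definition im_part : K -> R :=
  match F return scalars R F -> R with
  | RealScalars => fun=> 0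
  | ComplexScalars => fun z : R[i]%C => complex.Im z
  end.

Lemma modulus_sqr (x : K) : modulus x ^+ 2 = re_part x ^+ 2 + im_part x ^+ 2.
Proof.
rewrite /modulus /re_part /im_part; case: F x => [x|[a b]] /=.
  by rewrite expr0n addr0 real_normK ?num_real.
by rewrite sqr_sqrtr // addr_ge0 ?sqr_ge0.
Qed.

Lemma modulus_ge0 (x : K) : 0 <= modulus x.
Proof.
by rewrite /modulus; case: F x => [x|[a b]] //=; rewrite sqrtr_ge0.
Qed.

Lemma modulusM (x y : K) : modulus (x * y) = modulus x * modulus y.
Proof.
rewrite /modulus; case: F x y => [x y|x y] /=; first exact: normrM.
exact: ComplexField.Normc.normcM.
Qed.

Lemma modulusD (x y : K) : modulus (x + y) <= modulus x + modulus y.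
Proof.
rewrite /modulus; case: F x y => [x y|x y] /=; first exact: ler_normD.
exact: le_normcD.
Qed.

Lemma modulus_of_real r : modulus (of_real r) = `|r|.
Proof.
rewrite /modulus /of_real; case: F => //=.
by rewrite expr0n addr0 sqrtr_sqr.
Qed.

Lemma modulus0 : modulus (0 : K) = 0.
Proof.
rewrite /modulus; case: F => /=; first exact: normr0.
exact: ComplexField.Normc.normc0.
Qed.

Lemma modulus1 : modulus (1 : K) = 1.
Proof.
rewrite /modulus; case: F => /=; first exact: normr1.
exact: ComplexField.Normc.normc1.
Qed.

Lemma modulus_sum (I : finType) (P : pred I) (f : I -> K) :
  modulus (\sum_(i | P i) f i) <= \sum_(i | P i) modulus (f i).
Proof.
elim/big_ind2: _ => [|x1 x2 y1 y2 h1 h2|//]; first by rewrite modulus0.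
exact: le_trans (modulusD _ _) (lerD h1 h2).
Qed.

Lemma modulus_prod (I : finType) (f : I -> K) :
  modulus (\prod_i f i) = \prod_i modulus (f i).
Proof. exact: (big_morph _ modulusM modulus1). Qed.

Lemma of_realM x y : of_real (x * y) = of_real x * of_real y.
Proof. by rewrite /of_real; case: F => //=; rewrite rmorphM. Qed.

Lemma of_real1 : of_real 1 = 1.
Proof. by rewrite /of_real; case: F => //=; rewrite rmorph1. Qed.

Lemma of_real_prod (I : finType) (f : I -> R) :
  of_real (\prod_i f i) = \prod_i of_real (f i).
Proof. exact: (big_morph _ of_realM of_real1). Qed.

Lemma of_realD x y : of_real (x + y) = of_real x + of_real y.
Proof. by rewrite /of_real; case: F => //=; rewrite rmorphD. Qed.

Lemma of_real0 : of_real 0 = 0.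
Proof. by rewrite /of_real; case: F => //=; rewrite rmorph0. Qed.

Lemma of_real_sum (I : finType) (f : I -> R) :
  of_real (\sum_i f i) = \sum_i of_real (f i).
Proof. exact: (big_morph _ of_realD of_real0). Qed.

Lemma re_partD x y : re_part (x + y) = re_part x + re_part y.
Proof. by rewrite /re_part; case: F x y => // -[a b] [c d]. Qed.

Lemma im_partD x y : im_part (x + y) = im_part x + im_part y.
Proof. by rewrite /im_part; case: F x y => [x y|[a b] [c d]] //; rewrite addr0. Qed.

Lemma re_part0 : re_part 0 = 0.
Proof. by rewrite /re_part; case: F. Qed.

Lemma im_part0 : im_part 0 = 0.
Proof. by rewrite /im_part; case: F. Qed.

Lemma re_partZ r x : re_part (of_real r * x) = r * re_part x.
Proof.
by rewrite /re_part /of_real; case: F x => // -[a b] /=; rewrite mul0r subr0.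
Qed.

Lemma im_partZ r x : im_part (of_real r * x) = r * im_part x.
Proof.
rewrite /im_part /of_real; case: F x => [x|[a b]] /=; first by rewrite mulr0.
by rewrite mul0r addr0.
Qed.

Lemma re_part_sum (I : finType) (P : pred I) (f : I -> K) :
  re_part (\sum_(i | P i) f i) = \sum_(i | P i) re_part (f i).
Proof. exact: (big_morph _ re_partD re_part0). Qed.

Lemma im_part_sum (I : finType) (P : pred I) (f : I -> K) :
  im_part (\sum_(i | P i) f i) = \sum_(i | P i) im_part (f i).
Proof. exact: (big_morph _ im_partD im_part0). Qed.

Lemma re_part_le x : `|re_part x| <= modulus x.
Proof.
rewrite -(ler_pXn2r (n := 2)) ?nnegrE ?modulus_ge0 //.
by rewrite modulus_sqr real_normK ?num_real // lerDl sqr_ge0.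
Qed.

Lemma im_part_le x : `|im_part x| <= modulus x.
Proof.
rewrite -(ler_pXn2r (n := 2)) ?nnegrE ?modulus_ge0 //.
by rewrite modulus_sqr real_normK ?num_real // lerDr sqr_ge0.
Qed.

Lemma modulus_le_parts x : modulus x <= `|re_part x| + `|im_part x|.
Proof.
rewrite -(ler_pXn2r (n := 2)) ?nnegrE ?modulus_ge0 ?addr_ge0 //.
rewrite modulus_sqr sqrrD !real_normK ?num_real //.
by rewrite addrAC lerDl mulrn_wge0 // mulr_ge0.
Qed.

End Scalars.

Section LnormBounds.
Variables (R : realType) (n : nat).
Implicit Types (q : \bar R) (a : 'I_n -> R).

Lemma lnorm_ge_coord q a i : (0 < q)%E -> `|a i| <= lnorm q a.
Proof.
case: q => [r||] //= r0; last by rewrite (le_bigmax _ (fun i => `|a i|)).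
rewrite lte_fin in r0.
rewrite -[leLHS](@powRr1 _ `|a i|) // -(@mulfV _ r) ?gt_eqF // powRrM.
apply: ge0_ler_powR; rewrite ?nnegrE ?powR_ge0 ?invr_ge0 ?(ltW r0) //.
  by apply: sumr_ge0 => j _; exact: powR_ge0.
rewrite (bigD1 i) //= lerDl.
by apply: sumr_ge0 => j _; exact: powR_ge0.
Qed.

Lemma lnorm_le1 r a : 0 < r -> (lnorm r%:E a <= 1) = (\sum_i `|a i| `^ r <= 1).
Proof.
move=> r0; rewrite -lnormE //.
have := lnorm_ge0 r%:E a; move: (lnorm _ _) => x x0; apply/idP/idP => h.
  have -> : 1 = 1 `^ r :> R by rewrite powR1.
  by apply: ge0_ler_powR; rewrite ?nnegrE ?ler01 // ltW.
rewrite leNgt; apply/negP => x1; move: h; rewrite leNgt => /negP; apply.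
have -> : 1 = 1 `^ r :> R by rewrite powR1.
by rewrite gt0_ltr_powR // nnegrE ler01.
Qed.

Lemma lnormy_le1 a : (lnorm +oo a <= 1) = [forall i, `|a i| <= 1].
Proof.
apply/idP/forallP => [h i|h]; last by apply: bigmax_le => // i _; exact: h.
by apply: le_trans h; exact: lnorm_ge_coord.
Qed.

End LnormBounds.

Section Forms.
Variables (R : realType) (F : scalar_kind).
Local Notation K := (scalars R F).

Definition vcons (T : Type) (m : nat) (u : T) (z : 'I_m -> T) : 'I_m.+1 -> T :=
  fun k => if unlift ord0 k is Some k' then z k' else u.

Lemma vcons_eta (T : Type) (m : nat) (z : 'I_m.+1 -> T) :
  vcons (z ord0) (fun k => z (lift ord0 k)) = z.
Proof. by apply: funext => k; rewrite /vcons; case: unliftP => [k'|] ->. Qed.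

Lemma replace_at_vcons0 (T : Type) (m : nat) (u v : T) (z : 'I_m -> T) :
  replace_at (vcons u z) ord0 v = vcons v z.
Proof.
apply: funext => k; rewrite /replace_at /vcons.
by case: unliftP => [k'|] -> //.
Qed.

Lemma replace_at_vconsS (T : Type) (m : nat) (u v : T) (z : 'I_m -> T) k :
  replace_at (vcons u z) (lift ord0 k) v = vcons u (replace_at z k v).
Proof.
apply: funext => k'; rewrite /replace_at /vcons.
by case: unliftP => [l|] -> //; rewrite (inj_eq lift_inj).
Qed.

Lemma multilinear_sum (m n : nat) (A : ('I_m -> 'rV[K]_n) -> K) z k
    (I : finType) (c : I -> K) (v : I -> 'rV[K]_n) : multilinear_form A ->
  A (replace_at z k (\sum_i c i *: v i)) = \sum_i c i * A (replace_at z k (v i)).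
Proof.
move=> /(_ z k) lA; pose f u := A (replace_at z k u).
have f0 : f 0 = 0.
  by have := lA (-1) 0 0; rewrite scaler0 addr0 mulN1r addNr.
have fS a u w : f (a *: u + w) = a * f u + f w by exact: lA.
rewrite -[LHS]/(f _).
by elim/big_rec2: _ => // i y1 y2 _ <-; rewrite fS.
Qed.

Lemma multilinear_expand (m n : nat) (A : ('I_m -> 'rV[K]_n) -> K) z :
  multilinear_form A ->
  A z = \sum_(j : {ffun 'I_m -> 'I_n})
          (\prod_k z k 0 (j k)) * A (fun k => delta_mx 0 (j k)).
Proof.
elim: m A z => [|m IH] A z lA.
  have j : {ffun 'I_0 -> 'I_n} by apply: finfun => -[].
  rewrite (sum_ffun0 _ j) big_ord0 mul1r; congr A.
  by apply: funext => -[].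
set z' := fun k => z (lift ord0 k).
rewrite -[in LHS](vcons_eta z) -(replace_at_vcons0 0) [in LHS](row_sum_delta (z _)).
rewrite multilinear_sum // sum_fcons; apply: eq_bigr => i _.
rewrite replace_at_vcons0 (IH (fun z' => A (vcons _ z'))); last first.
  move=> w k a u v /=; rewrite -!(replace_at_vconsS (delta_mx 0 i)).
  exact: lA.
rewrite mulr_sumr; apply: eq_bigr => j _.
rewrite mulrA big_ord_recl fcons0; congr (_ * _ * _).
  by apply: eq_bigr => k _; rewrite fconsS.
congr A; apply: funext => k; rewrite /vcons; case: unliftP => [k'|] ->.
  by rewrite fconsS.
by rewrite fcons0.
Qed.

Definition in_ball (m n : nat) (p : 'I_m -> \bar R) (z : 'I_m -> 'rV[K]_n) :=
  forall k, lnorm (p k) (fun i => modulus (z k 0 i)) <= 1.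

Lemma in_ball_coord (m n : nat) (p : 'I_m -> \bar R) (z : 'I_m -> 'rV[K]_n) k i :
  (forall k, 0 < p k)%E -> in_ball p z -> modulus (z k 0 i) <= 1.
Proof.
move=> p0 /(_ k); apply: le_trans.
have := lnorm_ge_coord (fun i => modulus (z k 0 i)) i (p0 k).
by rewrite ger0_norm ?modulus_ge0.
Qed.

Lemma modulus_expand_le (m n : nat) (c : {ffun 'I_m -> 'I_n} -> K)
    (z : 'I_m -> 'rV[K]_n) :
  modulus (\sum_(j : {ffun 'I_m -> 'I_n}) (\prod_k z k 0 (j k)) * c j) <=
  \sum_(j : {ffun 'I_m -> 'I_n}) (\prod_k modulus (z k 0 (j k))) * modulus (c j).
Proof.
apply: le_trans (modulus_sum _ _) _; apply: ler_sum => j _.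
by rewrite modulusM modulus_prod.
Qed.

Lemma form_norm_ub (m n : nat) (p : 'I_m -> \bar R)
    (A : ('I_m -> 'rV[K]_n) -> K) z :
  (forall k, 0 < p k)%E -> multilinear_form A -> in_ball p z ->
  modulus (A z) <= form_norm p A.
Proof.
move=> p0 lA zb; apply: ub_le_sup; last by exists z.
exists (\sum_(j : {ffun 'I_m -> 'I_n}) modulus (A (fun k => delta_mx 0 (j k)))).
move=> _ [w wb <-]; rewrite (multilinear_expand w lA).
apply: le_trans (modulus_expand_le _ _) _; apply: ler_sum => j _.
apply: ler_piMl; first exact: modulus_ge0.
rewrite prodr_ile1 // => k _; rewrite modulus_ge0 /=.
exact: in_ball_coord wb.
Qed.

Lemma in_ball0 (m n : nat) (p : 'I_m -> \bar R) :
  (forall k, 0 < p k)%E -> in_ball p (fun=> 0 : 'rV[K]_n).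
Proof.
move=> p0 k; case: (p k) (p0 k) => [r||] // r0.
  rewrite lnorm_le1 // big1 ?ler01 // => i _.
  by rewrite mxE modulus0 normr0 powR0 // gt_eqF.
by rewrite lnormy_le1; apply/forallP => i; rewrite mxE modulus0 normr0 ler01.
Qed.

Lemma form_norm_le (m n : nat) (p : 'I_m -> \bar R)
    (A : ('I_m -> 'rV[K]_n) -> K) M : (forall k, 0 < p k)%E ->
  (forall z, in_ball p z -> modulus (A z) <= M) -> form_norm p A <= M.
Proof.
move=> p0 AM; apply: ge_sup.
  by exists (modulus (A (fun=> 0))), (fun=> 0); first exact: in_ball0.
by move=> _ [z zb <-]; exact: AM.
Qed.

Lemma form_norm_ge0 (m n : nat) (p : 'I_m -> \bar R)
    (A : ('I_m -> 'rV[K]_n) -> K) :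
  (forall k, 0 < p k)%E -> multilinear_form A -> 0 <= form_norm p A.
Proof.
move=> p0 lA; apply: le_trans (form_norm_ub p0 lA (in_ball0 n p0)).
exact: modulus_ge0.
Qed.

Definition tensor_form (m n : nat) (b : {ffun 'I_m -> 'I_n} -> K)
    (z : 'I_m -> 'rV[K]_n) : K :=
   \sum_(j : {ffun 'I_m -> 'I_n}) (\prod_k z k 0 (j k)) * b j.

Lemma tensor_form_multilinear (m n : nat) (b : {ffun 'I_m -> 'I_n} -> K) :
  multilinear_form (tensor_form b).
Proof.
move=> z k a u v; rewrite /tensor_form /= mulr_sumr -big_split /=.
apply: eq_bigr => j _; rewrite mulrA -mulrDl; congr (_ * _).
rewrite (bigD1 k) //= [in X in _ = X + _](bigD1 k) //= [in X in _ = _ + X](bigD1 k) //=.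
rewrite /replace_at eqxx !mxE mulrDl mulrA.
by congr (_ * _ + _ * _); apply: eq_bigr => l /negbTE ->.
Qed.

Lemma tensor_form_coef (m n : nat) (b : {ffun 'I_m -> 'I_n} -> K) j :
  form_coef (tensor_form b) j = modulus (b [ffun k => j k]).
Proof.
rewrite /form_coef /tensor_form (bigD1 [ffun k => j k]) //=.
rewrite [X in X * _]big1 ?mul1r; last by move=> k _; rewrite mxE !ffunE !eqxx.
rewrite [X in _ + X]big1 ?addr0 //.
move=> j' jj'; have [k jk] : exists k, j' k != j k.
  apply/existsP; apply: contraNT jj'; rewrite negb_exists => /forallP e.
  by apply/eqP/ffunP => k; rewrite ffunE; apply/eqP; have := e k; rewrite negbK.
by rewrite (bigD1 k) //= mxE eqxx (negbTE jk) !mul0r.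
Qed.

End Forms.

(** * The exponents *)

Section Exponents.
Variables (R : realType) (m : nat) (p : 'I_m -> \bar R).
Hypothesis p1 : forall k, (1 <= p k)%E.

Definition tsum (k : nat) : R := \sum_(j < m | (k <= j)%N) rinv (p j).

Lemma le1e_gt0 k : (0 < p k)%E.
Proof. exact: lt_le_trans (p1 k). Qed.

Lemma inve_rinv k : ((p k)^-1)%E = (rinv (p k))%:E.
Proof.
have := p1 k; rewrite /rinv; case: (p k) => [r||] // r1.
have r0 : r != 0 by rewrite gt_eqF // (lt_le_trans ltr01).
by rewrite inver (negbTE r0).
Qed.

Lemma rinv_p_ge0 k : 0 <= rinv (p k).
Proof. by apply: rinv_ge0; exact: ltW (le1e_gt0 k). Qed.

Lemma tail_sumE k : tail_sum p k = (tsum k)%:E.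
Proof.
rewrite /tail_sum /tsum -sumEFin; apply: eq_bigr => j _; exact: inve_rinv.
Qed.

Lemma inve2 : (2^-1)%E = (2^-1)%R%:E :> \bar R.
Proof. by rewrite inver pnatr_eq0. Qed.

Lemma tsum_le k l : (k <= l)%N -> tsum l <= tsum k.
Proof.
move=> kl; rewrite /tsum [leLHS]big_mkcond [leRHS]big_mkcond.
apply: ler_sum => j _; case: ifP => [lj|_]; first by rewrite (leq_trans kl lj).
by case: ifP => // _; exact: rinv_p_ge0.
Qed.

Lemma tsum_recl (k : 'I_m) : tsum k = rinv (p k) + tsum k.+1.
Proof.
rewrite /tsum (bigD1 k) //=; congr (_ + _); apply: eq_bigl => j.
by rewrite andbC ltn_neqAle eq_sym.
Qed.

Variable k0 : 'I_m.
Hypothesis k0P : is_k0 p k0.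

Lemma tsum_k0_ge : 2^-1 <= tsum k0.
Proof. by case: k0P => + _; rewrite tail_sumE inve2 lee_fin. Qed.

Lemma tsum_gt_k0 k : (k0 < k)%N -> tsum k < 2^-1.
Proof.
move=> k0k; have [km|mk] := ltnP k m; last first.
  rewrite /tsum big1 // => j; rewrite leqNgt => /negP[].
  exact: leq_trans (ltn_ord j) mk.
rewrite ltNge; apply: contraL k0k => h; rewrite -leqNgt.
case: k0P => _ /(_ (Ordinal km)); apply.
by rewrite tail_sumE inve2 lee_fin.
Qed.

Lemma rinv_exponent k :
  rinv (exponent p k0 k) = if (k <= k0)%N then 1 - tsum k else 2^-1.
Proof.
rewrite /exponent; case: ifP => _; first by rewrite tail_sumE /rinv inveK.
by rewrite rinvE.
Qed.

Hypothesis tsum0 : tsum 0 = 1.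

Lemma exponent_gt0 k : (0 < exponent p k0 k)%E.
Proof.
rewrite /exponent; case: ifP => // _; rewrite tail_sumE -EFinB inver.
case: eqP => [|/eqP h] //; rewrite lte_fin invr_gt0 lt_def h /=.
by rewrite subr_ge0 -tsum0 tsum_le.
Qed.

(** The gaps [1/2 - 1/s_k] are the partial tails of a nonnegative sequence
    dominated by the [1/p_k]. *)
Definition gap (l : 'I_m) : R :=
  if (l < k0)%N then rinv (p l) else if l == k0 then tsum k0 - 2^-1 else 0.

Lemma gap_ge0 l : 0 <= gap l.
Proof.
rewrite /gap; case: ifP => _; first exact: rinv_p_ge0.
by case: ifP => // _; rewrite subr_ge0 tsum_k0_ge.
Qed.

Lemma gap_le l : gap l <= rinv (p l).
Proof.
rewrite /gap; case: ifP => // _; case: eqP => [->|_]; last exact: rinv_p_ge0.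
by rewrite lerBlDr tsum_recl lerD2l ltW // tsum_gt_k0.
Qed.

Lemma sum_gap (k : nat) :
  \sum_(l < m | (k <= l)%N) gap l = if (k <= k0)%N then tsum k - 2^-1 else 0.
Proof.
case: leqP => [kk0|k0k]; last first.
  apply: big1 => l kl; have k0l : (k0 < l)%N := leq_trans k0k kl.
  by rewrite /gap ltnNge (ltnW k0l) -val_eqE /= gtn_eqF.
rewrite (bigID (fun l : 'I_m => (l < k0)%N)) /=.
rewrite [X in _ + X](bigD1 k0) /=; last by rewrite ltnn kk0.
rewrite [X in _ + (_ + X)]big1 ?addr0; last first.
  by move=> l /andP[/andP[_ /negbTE lk0] /negbTE k0l]; rewrite /gap lk0 k0l.
rewrite (_ : gap k0 = tsum k0 - 2^-1); last by rewrite /gap ltnn eqxx.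
rewrite [tsum k]/tsum [in RHS](bigID (fun l : 'I_m => (l < k0)%N)) /= -addrA.
congr (_ + _); first by apply: eq_bigr => l /andP[_ lk0]; rewrite /gap lk0.
congr (_ - _); apply: eq_bigl => l; rewrite -leqNgt.
by case: (leqP k0 l) => [kl|]; rewrite ?andbF // (leq_trans kk0 kl).
Qed.

Lemma half_sub_exponent (k : 'I_m) :
  2^-1 - rinv (exponent p k0 k) = \sum_(l < m | (k <= l)%N) gap l.
Proof. by rewrite sum_gap rinv_exponent; case: ifP => _; field. Qed.

Lemma sum_tau_sub_gap : \sum_k 2 * (rinv (p k) - gap k) = 1.
Proof.
rewrite -mulr_sumr sumrB.
have := sum_gap 0; rewrite leq0n tsum0 => ->.
have := tsum0; rewrite /tsum => ->; by field.
Qed.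

End Exponents.

(** * The inequality *)

Section Inequality.
Variables (R : realType) (F : scalar_kind) (m n : nat) (p : 'I_m -> \bar R).
Hypothesis p1 : forall k, (1 <= p k)%E.
Local Notation K := (scalars R F).
Variable A : ('I_m -> 'rV[K]_n) -> K.
Hypothesis lA : multilinear_form A.

(** Real and imaginary parts of the coefficients, weighted by nonnegative
    vectors of the unit balls, are the coefficients of two chaoses bounded by
    the norm of the form. *)
Lemma weighted_coef_bound (w : 'I_m -> 'I_n -> R) :
  (forall k i, 0 <= w k i) -> (forall k, \sum_i w k i = 1) ->
  forall i, \sum_b Num.sqrt (\sum_(j : {ffun 'I_m -> 'I_n} | j i == b)
    (form_coef A j * \prod_k w k (j k) `^ rinv (p k)) ^+ 2) <=
  2 * Num.sqrt (3 ^+ m) * form_norm p A.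
Proof.
move=> w0 w1 i.
pose x (j : {ffun 'I_m -> 'I_n}) := \prod_k w k (j k) `^ rinv (p k).
pose a (j : {ffun 'I_m -> 'I_n}) := A (fun k => delta_mx 0 (j k)).
pose z (s : {ffun 'I_m -> {ffun 'I_n -> bool}}) k : 'rV[K]_n :=
  \row_l of_real F (sgn R (s k l) * w k l `^ rinv (p k)).
have zb s : in_ball p (z s).
  move=> k; have zE l : `|modulus (z s k 0 l)| = w k l `^ rinv (p k).
    rewrite mxE modulus_of_real normr_id normrM /sgn normrX normrN1 expr1n mul1r.
    by rewrite ger0_norm // powR_ge0.
  case: (p k) (p1 k) zE => [r||] // r1 zE.
    have r0 : 0 < r by rewrite lee_fin in r1; exact: lt_le_trans ltr01 r1.
    rewrite lnorm_le1 //.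
    under eq_bigr do rewrite zE rinvE // -powRrM mulVf ?gt_eqF // powRr1 //.
    by rewrite w1.
  by rewrite lnormy_le1; apply/forallP => l; rewrite zE rinvy powRr0.
have Az s : A (z s) = \sum_(j : {ffun 'I_m -> 'I_n})
    of_real F (x j * \prod_k sgn R (s k (j k))) * a j.
  rewrite (multilinear_expand _ lA); apply: eq_bigr => j _; congr (_ * _).
  under eq_bigr do rewrite mxE.
  rewrite -of_real_prod big_split /=; congr of_real; exact: mulrC.
have p0 := le1e_gt0 p1.
have reB s : `|chaos (fun j => re_part (a j) * x j) s| <= form_norm p A.
  apply: le_trans (form_norm_ub p0 lA (zb s)).
  apply: le_trans (re_part_le _); rewrite Az re_part_sum.
  rewrite le_eqVlt; apply/orP; left; apply/eqP; congr `|_|.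
  by apply: eq_bigr => j _; rewrite re_partZ; ring.
have imB s : `|chaos (fun j => im_part (a j) * x j) s| <= form_norm p A.
  apply: le_trans (form_norm_ub p0 lA (zb s)).
  apply: le_trans (im_part_le _); rewrite Az im_part_sum.
  rewrite le_eqVlt; apply/orP; left; apply/eqP; congr `|_|.
  by apply: eq_bigr => j _; rewrite im_partZ; ring.
have := lerD (chaos_mixed_bound i reB) (chaos_mixed_bound i imB).
rewrite (_ : _ * _ + _ * _ = 2 * Num.sqrt (3 ^+ m) * form_norm p A); last by ring.
apply: le_trans.
rewrite -big_split /=; apply: ler_sum => b _.
rewrite -/(x _).
set u := \sum_(j | _) (re_part _ * _) ^+ 2; set v := \sum_(j | _) (im_part _ * _) ^+ 2.
have -> : \sum_(j : {ffun 'I_m -> 'I_n} | j i == b)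
    (form_coef A j * \prod_k w k (j k) `^ rinv (p k)) ^+ 2 = u + v.
  rewrite -big_split; apply: eq_bigr => j _ /=.
  by rewrite !exprMn -mulrDl -modulus_sqr.
have u0 : 0 <= u by apply: sumr_ge0 => j _; exact: sqr_ge0.
have v0 : 0 <= v by apply: sumr_ge0 => j _; exact: sqr_ge0.
rewrite -(ler_pXn2r (n := 2)) ?nnegrE ?addr_ge0 ?sqrtr_ge0 //.
rewrite sqrrD !sqr_sqrtr ?addr_ge0 // addrAC lerDl mulrn_wge0 //.
Qed.

Lemma mixed_norm_exponent_le (k0 : 'I_m) :
  tsum p 0 = 1 -> is_k0 p k0 ->
  mixed_norm (exponent p k0) (form_coef A) <=
  2 * Num.sqrt (3 ^+ m) * form_norm p A.
Proof.
move=> T0 k0P; apply: (mixed_norm_le_of_marginals (tau := fun k => rinv (p k))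
  (c := gap p k0)).
- exact: exponent_gt0.
- by move=> j; exact: modulus_ge0.
- rewrite !mulr_ge0 ?sqrtr_ge0 //; apply: form_norm_ge0 => //; exact: le1e_gt0.
- exact: gap_ge0.
- exact: gap_le.
- exact: sum_tau_sub_gap.
- exact: half_sub_exponent.
- exact: weighted_coef_bound.
Qed.

End Inequality.

(** * Lower bounds for iterated norms *)

Section MixedNormLower.
Variables (R : realType) (n : nat).

Lemma lnorm_ge_cst (q : \bar R) (a : 'I_n -> R) c : (0 < n)%N ->
  (0 < q)%E -> 0 <= c -> (forall i, c <= a i) -> n%:R `^ rinv q * c <= lnorm q a.
Proof.
move=> n0 q0 c0 ca; have aE i : `|a i| = a i by rewrite ger0_norm // (le_trans c0).
case: q q0 => [r||] // q0.
  rewrite lte_fin in q0; rewrite rinvE // /lnorm.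
  have -> : c = (c `^ r) `^ r^-1 by rewrite -powRrM mulfV ?gt_eqF // powRr1.
  rewrite -powRM ?powR_ge0 //; apply: ge0_ler_powR.
  - by rewrite invr_ge0 ltW.
  - by rewrite nnegrE mulr_ge0 ?powR_ge0.
  - by rewrite nnegrE; apply: sumr_ge0 => i _; exact: powR_ge0.
  rewrite mulr_natl -[in leLHS](card_ord n) -sumr_const; apply: ler_sum => i _.
  rewrite aE; apply: ge0_ler_powR; rewrite ?nnegrE ?(ltW q0) //.
  exact: le_trans (ca i).
rewrite rinvy powRr0 mul1r; apply: le_trans (lnorm_ge_coord a (Ordinal n0) q0).
by rewrite aE.
Qed.

Lemma mixed_norm_ge_coord (m : nat) (t : 'I_m -> \bar R) (a : ('I_m -> 'I_n) -> R) j :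
  (forall k, 0 < t k)%E -> (forall j, 0 <= a j) -> a j <= mixed_norm t a.
Proof.
elim: m t a j => [|m IH] t a j t0 a0.
  by rewrite le_eqVlt; apply/orP; left; apply/eqP; congr a; apply: funext => -[].
apply: le_trans (lnorm_ge_coord _ (j ord0) (t0 ord0)).
rewrite ger0_norm; last by apply: mixed_norm_ge0.
apply: le_trans (IH _ _ (fun k => j (lift ord0 k)) _ _) => //.
by rewrite [ord_cons _ _](vcons_eta j).
Qed.

(** Fixing the indices before position [k] and choosing those after it as
    functions of the index at [k] leaves a single norm, the one at [k]. *)
Lemma mixed_norm_ge_position (m : nat) (t : 'I_m -> \bar R)
    (a : ('I_m -> 'I_n) -> R) (k : 'I_m) (o : 'I_n) :
  (forall k, 0 < t k)%E -> (forall j, 0 <= a j) ->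
  (forall i, exists2 j : 'I_m -> 'I_n, 1 <= a j &
     j k = i /\ forall l : 'I_m, (l < k)%N -> j l = o) ->
  n%:R `^ rinv (t k) <= mixed_norm t a.
Proof.
have n0 : (0 < n)%N by apply: leq_ltn_trans (ltn_ord o).
elim: m t a k => [|m IH] t a k; first by case: k.
move=> t0 a0 aj; have b0 i : 0 <= mixed_norm (fun k : 'I_m => t (lift ord0 k))
  (fun j => a (ord_cons i j)) by apply: mixed_norm_ge0.
case: (unliftP ord0 k) aj => [k'|] -> aj.
  apply: le_trans (lnorm_ge_coord _ o (t0 ord0)).
  rewrite ger0_norm //; apply: IH => // i.
  have [j aj1 [jk jl]] := aj i; exists (fun l => j (lift ord0 l)).
    rewrite -(jl ord0) //; by rewrite [ord_cons _ _](vcons_eta j).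
  by split=> // l lk; apply: jl; rewrite !lift0 ltnS.
rewrite -[leLHS]mulr1; apply: lnorm_ge_cst => // i.
have [j aj1 [<- _]] := aj i.
apply: le_trans (mixed_norm_ge_coord (fun k => j (lift ord0 k)) _ _) => //.
by rewrite [ord_cons _ _](vcons_eta j).
Qed.

Lemma mixed_norm_ge_box (m : nat) (t : 'I_m -> \bar R)
    (a : ('I_m -> 'I_n) -> R) (D : pred 'I_m) (o : 'I_n) :
  (forall k, 0 < t k)%E -> (forall j, 0 <= a j) ->
  (forall j : 'I_m -> 'I_n, (forall l, ~~ D l -> j l = o) -> 1 <= a j) ->
  \prod_(l | D l) n%:R `^ rinv (t l) <= mixed_norm t a.
Proof.
have n0 : (0 < n)%N by apply: leq_ltn_trans (ltn_ord o).
elim: m t a D => [|m IH] t a D t0 a0 aD.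
  by rewrite big_ord0; apply: aD => -[].
rewrite big_mkcond big_ord_recl -big_mkcond /=.
have b0 i : 0 <= mixed_norm (fun k : 'I_m => t (lift ord0 k))
  (fun j => a (ord_cons i j)) by apply: mixed_norm_ge0.
have slice i : (~~ D ord0 -> i = o) ->
    \prod_(l | D (lift ord0 l)) n%:R `^ rinv (t (lift ord0 l)) <=
    mixed_norm (fun k : 'I_m => t (lift ord0 k)) (fun j => a (ord_cons i j)).
  move=> Di; apply: (IH _ _ (fun l => D (lift ord0 l))) => // j jD.
  by apply: aD => l; rewrite /ord_cons; case: unliftP => [l'|] ->; [exact: jD|].
case: ifP => D0.
  apply: lnorm_ge_cst => //; first by apply: prodr_ge0 => l _; exact: powR_ge0.
  by move=> i; apply: slice; rewrite D0.
rewrite mul1r; apply: le_trans (lnorm_ge_coord _ o (t0 ord0)).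
by rewrite ger0_norm //; exact: slice.
Qed.

End MixedNormLower.

(** * Products of vectors in unit balls *)

Lemma powR_agm (R : realType) (I : finType) (th u : I -> R) :
  (forall i, 0 <= th i) -> \sum_i th i = 1 -> (forall i, 0 <= u i) ->
  \prod_i u i `^ th i <= \sum_i th i * u i.
Proof.
move=> th0 th1 u0.
have [/existsP[i /andP[/eqP ui thi]]|none] :=
    boolP [exists i, (u i == 0) && (th i != 0)].
  rewrite (bigD1 i) //= ui powR0 // mul0r.
  by apply: sumr_ge0 => j _; rewrite mulr_ge0.
have uth i : u i = 0 -> th i = 0.
  move=> ui; apply/eqP; apply: contraNT none => thi.
  by apply/existsP; exists i; rewrite ui eqxx.
have -> : \prod_i u i `^ th i = expR (\sum_i th i * ln (u i)).
  rewrite expR_sum; apply: eq_bigr => i _.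
  have [ui|ui] := eqVneq (u i) 0; last by rewrite /powR (negbTE ui).
  by rewrite uth // powRr0 mul0r expR0.
apply: le_trans (expR_jensen _ th0 th1) _; apply: ler_sum => i _.
have [ui|ui] := eqVneq (u i) 0; first by rewrite uth // !mul0r.
by rewrite lnK // posrE lt_def ui u0.
Qed.

(** Hölder's inequality on the unit balls of the spaces [l_(p l)]; the missing
    exponent [1 - T] is supplied by the constant vector. *)
Lemma holder_in_balls (R : realType) (m n : nat) (p : 'I_m -> \bar R)
    (x : 'I_m -> 'I_n -> R) (D : pred 'I_m) : (0 < n)%N ->
  (forall l, 0 < p l)%E -> (forall l i, 0 <= x l i) ->
  (forall l, lnorm (p l) (x l) <= 1) -> \sum_(l | D l) rinv (p l) <= 1 ->
  \sum_i \prod_(l | D l) x l i <= n%:R `^ (1 - \sum_(l | D l) rinv (p l)).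
Proof.
move=> n0 p0 x0 x1; set T := \sum_(l | D l) _ => T1.
have nR : (0 : R) < n%:R by rewrite ltr0n.
have [u [u0 u1 xu]] : exists u : 'I_m -> 'I_n -> R,
  [/\ forall l i, 0 <= u l i, forall l, \sum_i u l i <= 1 &
      forall l i, x l i <= u l i `^ rinv (p l)].
  suff /boolp.choice [u ul] : forall l, exists ul : 'I_n -> R,
    [/\ forall i, 0 <= ul i, \sum_i ul i <= 1 &
      forall i, x l i <= ul i `^ rinv (p l)].
    by exists u; split=> l; case: (ul l).
  move=> l; move: (p0 l) (x1 l); case: (p l) => [r||] // r0 xl.
    rewrite lte_fin in r0.
    exists (fun i => x l i `^ r); split=> [i||i]; first exact: powR_ge0.
      move: xl; rewrite lnorm_le1 //; congr (_ <= _).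
      by apply: eq_bigr => i _; rewrite ger0_norm.
    by rewrite rinvE // -powRrM mulfV ?gt_eqF // powRr1.
  exists (fun=> n%:R^-1); split=> [i||i]; first by rewrite invr_ge0 ltW.
    by rewrite sumr_const card_ord -[_ *+ n]mulr_natr mulVf // gt_eqF.
  rewrite rinvy powRr0; move: xl; rewrite lnormy_le1 => /forallP /(_ i).
  by rewrite ger0_norm.
pose th := vcons (1 - T) (fun l => if D l then rinv (p l) else 0).
have th0 k : 0 <= th k.
  rewrite /th /vcons; case: unlift => [l|]; last by rewrite subr_ge0.
  by case: ifP => // _; apply: rinv_ge0; exact: ltW.
have thS : \sum_k th k = 1.
  rewrite big_ord_recl {1}/th /vcons unlift_none.
  under eq_bigr do rewrite /th /vcons liftK.
  by rewrite -big_mkcond -/T subrK.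
pose v i := vcons n%:R^-1 (fun l => u l i).
have v0 i k : 0 <= v i k.
  by rewrite /v /vcons; case: unlift => [l|]; rewrite ?invr_ge0 ?ler0n.
have step i : \prod_(l | D l) x l i <=
    n%:R `^ (1 - T) * \sum_k th k * v i k.
  apply: le_trans (ler_wpM2l (powR_ge0 _ _) (powR_agm th0 thS (v0 i))).
  rewrite big_ord_recl {1}/th {1}/v /vcons unlift_none mulrA.
  rewrite -powRM ?invr_ge0 ?ler0n // divff ?gt_eqF // powR1 mul1r.
  rewrite big_mkcond; apply: ler_prod => l _; rewrite /th /v /vcons !liftK.
  by case: ifP => // _; rewrite ?powRr0 ?ler01 ?lexx // x0 xu.
apply: le_trans (ler_sum _ (fun i _ => step i)) _.
rewrite -mulr_sumr ler_piMr ?powR_ge0 // exchange_big /=.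
rewrite -[leRHS]thS; apply: ler_sum => k _.
rewrite -mulr_sumr ler_piMr // /v /vcons; case: unlift => [l|]; first exact: u1.
by rewrite sumr_const card_ord -[_ *+ n]mulr_natr mulVf // gt_eqF.
Qed.

(** * Growth along powers of two *)

(** Replacing [g] by [g / (d + 1)], Bernoulli's inequality makes the left-hand
    side grow at least like [N ^ (d + 1)] if [g] is positive. *)
Lemma powR_growth (R : realType) (g C : R) (d : nat) :
  (forall N : nat, (2 ^ N)%:R `^ g <= C * N.+1%:R ^+ d) -> g <= 0.
Proof.
move=> gC; rewrite leNgt; apply/negP => g0.
pose e := g / d.+1%:R; have e0 : 0 < e by rewrite divr_gt0 ?ltr0n.
pose h : R := Num.min 1 (2 `^ e - 1).
have h0 : 0 < h.
  rewrite lt_min ltr01 subr_gt0 /powR pnatr_eq0 /= expR_gt1 mulr_gt0 //.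
  by rewrite ln_gt0 // ltr1n.
have lin N : h * N.+1%:R <= (2 ^ N)%:R `^ e.
  have -> : (2 ^ N)%:R `^ e = (2 `^ e) ^+ N :> R.
    by rewrite natrX -powR_mulrn ?ler0n // powRAC powR_mulrn ?powR_ge0.
  have h1 : h <= 1 by rewrite ge_min lexx.
  have h2 : 1 + h <= 2 `^ e by rewrite -lerBrDl ge_min lexx orbT.
  elim: {e0 gC}N => [|M IH]; first by rewrite expr0 mulr1.
  have p1 : 1 <= (2 `^ e) ^+ M by rewrite exprn_ege1 // (le_trans _ h2) // lerDl ltW.
  rewrite exprSr -[M.+2]addn1 natrD mulrDr mulr1.
  apply: le_trans (ler_wpM2l (le_trans ler01 p1) h2).
  by rewrite mulrDr mulr1 lerD // ler_peMl // ltW.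
have C0 : 0 <= C.
  by have := gC 0%N; rewrite expn0 powR1 expr1n mulr1; exact: le_trans.
have key N : h ^+ d.+1 * N.+1%:R <= C.
  have N0 : (0 : R) < N.+1%:R ^+ d by rewrite exprn_gt0 ?ltr0n.
  rewrite -(ler_pM2r N0); apply: le_trans (gC N).
  rewrite -mulrA -exprS -exprMn.
  have -> : (2 ^ N)%:R `^ g = ((2 ^ N)%:R `^ e) ^+ d.+1 :> R.
    by rewrite -powR_mulrn ?powR_ge0 // -powRrM /e -mulrA mulVf ?mulr1.
  by apply: lerXn2r (lin N); rewrite nnegrE ?powR_ge0 // mulr_ge0 ?ltW ?ler0n.
have h'0 : 0 < h ^+ d.+1 by rewrite exprn_gt0.
have := key (Num.truncn (C / h ^+ d.+1)).
rewrite -ler_pdivlMl // mulrC leNgt => /negP; apply.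
by apply: truncnS_gt.
Qed.

(** * Optimality of the exponents up to the critical position *)

Section Diagonal.
Variables (R : realType) (F : scalar_kind) (m : nat) (p : 'I_m -> \bar R).
Hypothesis p1 : forall k, (1 <= p k)%E.
Hypothesis tsum0 : tsum p 0 = 1.
Local Notation K := (scalars R F).

Definition diag_index (n : nat) (o : 'I_n) (k : 'I_m) (i : 'I_n) :
    {ffun 'I_m -> 'I_n} := [ffun l : 'I_m => if (l < k)%N then o else i].

Lemma diag_indexk (n : nat) (o : 'I_n) (k : 'I_m) i : diag_index o k i k = i.
Proof. by rewrite ffunE ltnn. Qed.

(** The coefficients of the form
    [z_0(o) ... z_(k-1)(o) * sum_i z_k(i) ... z_(m-1)(i)], which by Hölder has
    norm at most [n ^ (1 - T_k)], while its iterated norm is at least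
    [n ^ (1 / t_k)] whatever the other exponents are. *)
Definition diag_coef (n : nat) (o : 'I_n) (k : 'I_m) (j : {ffun 'I_m -> 'I_n}) : K :=
  (j == diag_index o k (j k))%:R.

Lemma diag_form_norm (n : nat) (o : 'I_n) (k : 'I_m) :
  form_norm p (tensor_form (diag_coef o k)) <= n%:R `^ (1 - tsum p k).
Proof.
have n0 : (0 < n)%N by apply: leq_ltn_trans (ltn_ord o).
have p0 := le1e_gt0 p1.
apply: form_norm_le => // z zb.
apply: le_trans (modulus_expand_le _ _) _.
have T1 : \sum_(l < m | (k <= l)%N) rinv (p l) <= 1.
  by rewrite -tsum0; exact: tsum_le.
apply: le_trans (holder_in_balls (x := fun l i => modulus (z l 0 i)) n0 p0 _ zb T1);
  last by move=> l i; exact: modulus_ge0.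
rewrite (partition_big (fun j : {ffun 'I_m -> 'I_n} => j k) xpredT) //=.
apply: ler_sum => i _.
have idxk := diag_indexk o k i.
rewrite (bigD1 (diag_index o k i)) /=; last by rewrite idxk.
rewrite [X in _ + X]big1 ?addr0; last first.
  move=> j /andP[/eqP jk ji]; rewrite /diag_coef jk (negbTE ji).
  by rewrite modulus0 mulr0.
rewrite /diag_coef idxk eqxx modulus1 mulr1 [leRHS]big_mkcond.
apply: ler_prod => l _; rewrite modulus_ge0 /= ffunE ltnNge.
by case: (k <= l)%N => //=; exact: in_ball_coord zb.
Qed.

Lemma rinv_le_of_admissible (t : 'I_m -> \bar R) (k : 'I_m) :
  admissible F p t -> rinv (t k) <= 1 - tsum p k.
Proof.
case=> t0 [C tC]; rewrite -subr_le0.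
apply: (@powR_growth _ _ `|C| 0) => N; rewrite expr0 mulr1.
set n := (2 ^ N)%N; have n0 : (0 < n)%N by rewrite expn_gt0.
have nR : n%:R != 0 :> R by rewrite pnatr_eq0 -lt0n.
rewrite powRB ?nR ?implybT // ler_pdivrMr ?powR_gt0 ?ltr0n //.
pose o := Ordinal n0; pose A := tensor_form (diag_coef o k).
have lA : multilinear_form A by exact: tensor_form_multilinear.
apply: le_trans (_ : _ <= mixed_norm t (form_coef A)) _.
  apply: (mixed_norm_ge_position (o := o)) => // [j|i]; first exact: modulus_ge0.
  exists (diag_index o k i); last first.
    by split=> [|l lk]; rewrite ffunE ?ltnn ?lk.
  rewrite tensor_form_coef (_ : [ffun l => _] = diag_index o k i); last first.
    by apply/ffunP => l; rewrite ffunE.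
  by rewrite /diag_coef diag_indexk eqxx modulus1.
apply: le_trans (tC _ _ n0 lA) _.
apply: le_trans (ler_wpM2l (normr_ge0 C) (diag_form_norm o k)).
by rewrite ler_wpM2r ?ler_norm // form_norm_ge0 // => l; exact: le1e_gt0.
Qed.

Lemma exponent_optimal (k0 k : 'I_m) : is_k0 p k0 -> (k <= k0)%N ->
  optimal_at F p (exponent p k0) k.
Proof.
move=> k0P kk0 t adm; have := rinv_le_of_admissible k adm.
case: adm => /(_ k) + _; rewrite /exponent kk0 tail_sumE //.
case: (t k) => [r||] //; last by rewrite leey.
rewrite lte_fin => r0; rewrite rinvE // => rT.
have T0 : 0 < 1 - tsum p k by rewrite (lt_le_trans _ rT) // invr_gt0.
rewrite -EFinB inver gt_eqF // lee_fin -[leRHS]invrK lef_pV2 ?posrE //.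
by rewrite invr_gt0.
Qed.

End Diagonal.

(** * Sign tensors with small multilinear norm *)

(** Families of such values are the sign vectors supported on arbitrary sets of
    indices; [None] marks an index outside the support. *)
Definition ternary (R : pzRingType) (x : option bool) : R :=
  if x is Some b then sgn R b else 0.

Lemma ternary_norm (R : realDomainType) x : `|ternary R x| = ternary R x ^+ 2.
Proof.
case: x => [[]|] /=; rewrite /sgn ?expr1 ?expr0 ?normrN ?normr1 ?normr0 //.
- by rewrite sqrrN expr1n.
- by rewrite expr1n.
- by rewrite expr0n.
Qed.

Lemma ternary_le1 (R : realDomainType) x : ternary R x ^+ 2 <= 1.
Proof.
by case: x => [[]|] /=; rewrite /sgn ?expr1 ?expr0 ?sqrrN ?expr1n ?expr0n ?ler01.
Qed.

(** The tangent inequality [1 - x <= expR (- x)] bounds [expR x] by [1 / (1 - x)],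
    and the two resulting fractions add up to [2 / (1 - x ^+ 2)]. *)
Lemma cosh_le (R : realType) (x : R) : x ^+ 2 <= 2^-1 ->
  expR x + expR (- x) <= 2 * expR (2 * x ^+ 2).
Proof.
move=> x2; have x1 : `|x| < 1.
  rewrite -(ltr_pXn2r (n := 2)) ?nnegrE // real_normK ?num_real // expr1n.
  by apply: le_lt_trans x2 _; rewrite invf_lt1 ?ltr1n.
have {x1} : -1 < x < 1 by rewrite -ltr_norml.
move=> /andP[xN1 x1].
have h1 : expR x <= (1 - x)^-1.
  rewrite -[expR x]invrK lef_pV2 ?posrE ?invr_gt0 ?expR_gt0 ?subr_gt0 //.
  by rewrite -expRN expR_ge1Dx.
have h2 : expR (- x) <= (1 + x)^-1.
  rewrite expRN lef_pV2 ?posrE ?expR_gt0 ?expR_ge1Dx //.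
  by rewrite -ltrBlDl sub0r.
apply: le_trans (lerD h1 h2) _.
apply: (@le_trans _ _ (2 * (1 + 2 * x ^+ 2))); last first.
  by rewrite ler_pM2l // expR_ge1Dx.
have p1 : 0 < 1 - x by rewrite subr_gt0.
have p2 : 0 < 1 + x by rewrite -ltrBlDl sub0r.
rewrite -(ler_pM2r (mulr_gt0 p1 p2)).
have -> : ((1 - x)^-1 + (1 + x)^-1) * ((1 - x) * (1 + x)) = 2.
  by field; rewrite !gt_eqF.
have : 0 <= x ^+ 2 by exact: sqr_ge0.
have -> : (1 - x) * (1 + x) = 1 - x ^+ 2 by ring.
nra.
Qed.

(** Exponential moments of a Rademacher sum, by independence of the signs. *)
Lemma rademacher_exp_moment (R : realType) (I : finType) (a : I -> R) (la : R) :
  (forall i, a i ^+ 2 <= 1) -> la ^+ 2 <= 2^-1 ->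
  \sum_(e : {ffun I -> bool}) expR (la * \sum_i sgn R (e i) * a i) <=
  2 ^+ #|I| * expR (2 * la ^+ 2 * \sum_i a i ^+ 2).
Proof.
move=> a1 la2.
under eq_bigr do rewrite mulr_sumr expR_sum.
rewrite -(bigA_distr_bigA (fun i b => expR (la * (sgn R b * a i)))) /=.
rewrite mulr_sumr expR_sum -prodr_const -big_split /=.
apply: ler_prod => i _; rewrite big_bool /sgn expr1 expr0 mulN1r mul1r mulrN.
rewrite addr_ge0 ?expR_ge0 //= addrC -mulrA -exprMn.
apply: cosh_le; rewrite exprMn; apply: le_trans la2.
by rewrite ler_piMr ?sqr_ge0.
Qed.

Section SignTensor.
Variables (R : realType) (m n : nat).
Local Notation J := {ffun 'I_m -> 'I_n}.
Local Notation tests := {ffun 'I_m -> {ffun 'I_n -> option bool}}.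

Definition box_size (v : tests) : R := \prod_k \sum_i ternary R (v k i) ^+ 2.

Definition tensor_test (e : {ffun J -> bool}) (v : tests) : R :=
  \sum_j sgn R (e j) * \prod_k ternary R (v k (j k)).

Lemma box_sizeE v : box_size v = \sum_(j : J) (\prod_k ternary R (v k (j k))) ^+ 2.
Proof.
rewrite /box_size bigA_distr_bigA /=; apply: eq_bigr => j _.
by rewrite prodrXl.
Qed.

Lemma box_size_ge0 v : 0 <= box_size v.
Proof. by rewrite box_sizeE; apply: sumr_ge0 => j _; exact: sqr_ge0. Qed.

Lemma tensor_test_trivial e v : `|tensor_test e v| <= box_size v.
Proof.
rewrite box_sizeE; apply: le_trans (ler_norm_sum _ _ _) _.
apply: ler_sum => j _; rewrite normrM /sgn normrX normrN1 expr1n mul1r.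
rewrite normr_prod -prodrXl; under eq_bigr do rewrite ternary_norm.
by [].
Qed.

(* Large enough for the tail bound to beat the number of tests. *)
Let kappa : R := 16 * m.+1%:R.

(** Chernoff's bound at the level [L]: the parameter [la] minimises the exponent
    [2 * la ^+ 2 * box_size v - la * L], and the size condition on the box keeps
    it in the range where the exponential moment bound applies. *)
Lemma tensor_test_exp_moment v : kappa * n%:R <= box_size v -> 0 < box_size v ->
  forall L la, L = Num.sqrt (kappa * n%:R * box_size v) ->
  la = L / (4 * box_size v) ->
  \sum_e (expR (la * tensor_test e v) + expR (la * - tensor_test e v)) *
     expR (- (la * L)) <=
  2 ^+ #|J| * (2 * expR (- (2 * m.+1%:R * n%:R))).
Proof.
move=> big V0 L la LE laE.
have L2 : L ^+ 2 = kappa * n%:R * box_size v.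
  by rewrite LE sqr_sqrtr // !mulr_ge0 ?ler0n // ltW.
have la2 : la ^+ 2 = kappa * n%:R / (16 * box_size v).
  by rewrite laE expr_div_n L2; field; rewrite gt_eqF.
have laL : la * L = kappa * n%:R / 4.
  by rewrite laE mulrAC -expr2 L2; field; rewrite gt_eqF.
have la_small : la ^+ 2 <= 2^-1.
  rewrite la2 ler_pdivrMr ?mulr_gt0 //; apply: le_trans big _; lra.
have a1 (j : J) : (\prod_k ternary R (v k (j k))) ^+ 2 <= 1.
  by rewrite -prodrXl prodr_ile1 // => k _; rewrite sqr_ge0 ternary_le1.
have moment s : s ^+ 2 = la ^+ 2 ->
    \sum_e expR (s * tensor_test e v) <=
    2 ^+ #|J| * expR (2 * la ^+ 2 * box_size v).
  move=> sla; rewrite -sla box_sizeE; apply: rademacher_exp_moment => //.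
  by rewrite sla.
rewrite -mulr_suml big_split /=.
under [X in _ + X]eq_bigr do rewrite mulrN -mulNr.
have := lerD (moment la erefl) (moment (- la) (sqrrN _)).
rewrite -(ler_pM2r (expR_gt0 (- (la * L)))) => /le_trans; apply.
rewrite -!mulrDr -mulr2n -mulrA ler_pM2l ?exprn_gt0 //.
rewrite -[_ *+ 2]mulr_natl -mulrA.
rewrite ler_pM2l // -expRD ler_expR laL la2 /kappa.
rewrite le_eqVlt; apply/orP; left; apply/eqP.
by field; rewrite gt_eqF.
Qed.

(** If every sign tensor violated the bound on some test, the exponential
    moments summed over all [3^(n m)] tests would exceed their upper bound.
    Tests supported on a box with at most [kappa n] cells are bounded
    trivially. *)
Lemma exists_sign_tensor : (0 < n)%N -> exists e : {ffun J -> bool},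
  forall v, `|tensor_test e v| <= Num.sqrt (16 * m.+1%:R * n%:R * box_size v).
Proof.
move=> n0; apply: contrapT => none.
pose L v := Num.sqrt (kappa * n%:R * box_size v).
pose la v := L v / (4 * box_size v).
pose big v := (kappa * n%:R <= box_size v) && (0 < box_size v).
pose Z e v := (expR (la v * tensor_test e v) + expR (la v * - tensor_test e v)) *
     expR (- (la v * L v)).
have Z0 e v : 0 <= Z e v by rewrite mulr_ge0 ?addr_ge0 ?expR_ge0.
have bad e : 1 <= \sum_(v | big v) Z e v.
  have [v] : exists v, ~ `|tensor_test e v| <= L v.
    by apply: contrapT => h; apply: none; exists e => v; apply: contrapT => hv;
      apply: h; exists v.
  move/negP; rewrite -ltNge => Lv.
  have V0 : 0 < box_size v.
    rewrite lt_def box_size_ge0 andbT; apply: contraTneq Lv => V0.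
    by rewrite -leNgt (le_trans (tensor_test_trivial _ _)) // V0 sqrtr_ge0.
  have bv : big v.
    rewrite /big V0 andbT leNgt; apply: contraTN Lv => small; rewrite -leNgt.
    apply: le_trans (tensor_test_trivial _ _) _.
    rewrite -(ler_pXn2r (n := 2)) ?nnegrE ?sqrtr_ge0 ?box_size_ge0 //.
    rewrite sqr_sqrtr ?mulr_ge0 ?ler0n ?box_size_ge0 //.
    by rewrite expr2 ler_pM2r // ltW.
  have la0 : 0 <= la v by rewrite divr_ge0 ?sqrtr_ge0 // mulr_ge0 // ltW.
  rewrite (bigD1 v) //=; apply: le_trans (_ : Z e v <= _); last first.
    by rewrite lerDl; apply: sumr_ge0.
  rewrite /Z expRN ler_pdivlMr ?expR_gt0 // mul1r.
  have := ltW Lv; rewrite ler_normr => /orP[] h.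
    by rewrite ler_wpDr ?expR_ge0 // ler_expR ler_wpM2l.
  by rewrite ler_wpDl ?expR_ge0 // ler_expR ler_wpM2l.
have : \sum_(e : {ffun J -> bool}) (1 : R) <= \sum_e \sum_(v | big v) Z e v.
  by apply: ler_sum.
rewrite sumr_const card_ffun card_bool exchange_big /= => h.
have {h} : 2 ^+ #|J| <=
    \sum_(v : tests) 2 ^+ #|J| * (2 * expR (- (2 * m.+1%:R * n%:R))) :> R.
  rewrite -natrX; apply: le_trans h _; rewrite big_mkcond; apply: ler_sum => v _.
  case: ifP => [/andP[b1 b2]|_].
    by rewrite natrX; exact: tensor_test_exp_moment erefl erefl.
  by rewrite !mulr_ge0 ?expR_ge0 ?ler0n.
rewrite sumr_const -[leRHS]mulr_natr -mulrA -[leLHS]mulr1 ler_pM2l ?exprn_gt0 //.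
rewrite !card_ffun card_option card_bool !card_ord leNgt => /negP; apply.
rewrite expRN mulrAC ltr_pdivrMr ?expR_gt0 // mul1r.
have e4 : 4 <= expR (2 : R).
  have -> : expR (2 : R) = expR 1 ^+ 2 by rewrite -expRM_natl mulr1.
  have -> : 4 = 2 ^+ 2 :> R by rewrite -natrX.
  by apply: lerXn2r; rewrite ?nnegrE ?expR_ge0 // expR_ge1Dx.
have -> : 2 * m.+1%:R * n%:R = 2 * (n * m.+1)%:R :> R.
  by rewrite natrM -mulrA [m.+1%:R * _]mulrC.
rewrite expRM_natr.
apply: lt_le_trans (_ : _ < 4 ^+ (n * m.+1)) _; last first.
  by apply: lerXn2r; rewrite ?nnegrE ?expR_ge0.
rewrite -!natrX -natrM ltr_nat -expnM mulnS expnD.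
apply: leq_ltn_trans (_ : 2 * 4 ^ (n * m) < _)%N.
  by rewrite leq_mul2l /=; case: (n * m)%N => // e; rewrite leq_exp2r.
rewrite ltn_pmul2r ?expn_gt0 //.
by apply: leq_trans (_ : 4 ^ 1 <= _)%N; rewrite ?leq_exp2l.
Qed.

End SignTensor.

(** * From sign vectors to Euclidean balls *)

Definition harmonic_sum (R : realType) (n : nat) : R := \sum_(r < n) r.+1%:R^-1.

Lemma harmonic_sum_ge0 (R : realType) n : 0 <= harmonic_sum R n.
Proof. by apply: sumr_ge0 => r _; rewrite invr_ge0. Qed.

Lemma harmonic_sum_pow2 (R : realType) N : harmonic_sum R (2 ^ N) <= N.+1%:R.
Proof.
elim: N => [|N IH]; first by rewrite /harmonic_sum big_ord1 invr1.
rewrite expnS mul2n -addnn /harmonic_sum big_split_ord /= -[N.+2]addn1 natrD.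
apply: lerD IH _.
apply: (@le_trans _ _ (\sum_(r < 2 ^ N) (2 ^ N)%:R^-1)).
  apply: ler_sum => r _; rewrite lef_pV2 ?posrE ?ltr0n ?expn_gt0 //.
  by rewrite ler_nat -addnS leq_addr.
by rewrite sumr_const card_ord -[_ *+ _]mulr_natr mulVf.
Qed.

(** A family in weak [l_2] is in [l_2] up to a logarithm: the smallest of [r]
    entries has square at most [D^2 / r], so removing the smallest entry over
    and over sums these bounds. *)
Lemma weak_l2 (R : realType) (n : nat) (x : 'I_n -> R) (D : R) :
  (forall i, 0 <= x i) ->
  (forall S : {set 'I_n}, \sum_(i in S) x i <= D * Num.sqrt #|S|%:R) ->
  forall S : {set 'I_n}, \sum_(i in S) x i ^+ 2 <= D ^+ 2 * harmonic_sum R #|S|.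
Proof.
move=> x0 xD S; move: {2}#|S| (erefl #|S|) => r; elim: r S => [|r IH] S Sr.
  move/eqP: Sr; rewrite cards_eq0 => /eqP ->.
  by rewrite big_set0 mulr_ge0 ?sqr_ge0 ?harmonic_sum_ge0.
have [i0 i0S] : exists i, i \in S by apply/set0Pn; rewrite -card_gt0 Sr.
have [i iS imin] : exists2 i, i \in S & forall j, j \in S -> x i <= x j.
  by case: (Order.TotalTheory.arg_minP x i0S) => i iS imin; exists i.
have card_Si : #|S :\ i| = r by move: (cardsD1 i S); rewrite iS Sr => -[].
rewrite (big_setD1 i) //= Sr /harmonic_sum big_ord_recr /= mulrDr addrC.
apply: lerD; first by have := IH _ card_Si; rewrite card_Si.
have r0 : (0 : R) < r.+1%:R by rewrite ltr0n.
have D0 : 0 <= D.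
  have s0 : 0 < Num.sqrt r.+1%:R :> R by rewrite sqrtr_gt0.
  rewrite -(pmulr_lge0 _ s0) -Sr.
  have h1 : 0 <= \sum_(i in S) x i by apply: sumr_ge0.
  have h2 := xD S.
  exact: le_trans h1 h2.
have h : r.+1%:R * x i <= D * Num.sqrt r.+1%:R.
  have := xD S; rewrite Sr; apply: le_trans.
  by rewrite mulr_natl -Sr -sumr_const; apply: ler_sum => j jS; exact: imin.
have {}h : (r.+1%:R * x i) ^+ 2 <= D ^+ 2 * r.+1%:R.
  rewrite -[X in _ <= _ * X](sqr_sqrtr (ltW r0)) -exprMn.
  by apply: lerXn2r h; rewrite nnegrE ?mulr_ge0 ?sqrtr_ge0 // ltW.
rewrite ler_pdivlMr // -(ler_pM2l r0); move: h; congr (_ <= _); ring.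
Qed.

Section EuclideanBalls.
Variables (R : realType) (F : scalar_kind) (n : nat).
Local Notation K := (scalars R F).

Definition ternary_vec (v : {ffun 'I_n -> option bool}) : 'rV[K]_n :=
  \row_i of_real F (ternary R (v i)).

Definition euclid (u : 'rV[K]_n) : R :=
  Num.sqrt (\sum_i modulus (u 0 i) ^+ 2).

Lemma euclid_ge0 u : 0 <= euclid u.
Proof. exact: sqrtr_ge0. Qed.

(** Testing a functional on sign vectors supported on [S] bounds the sum of the
    moduli of its coefficients over [S], real and imaginary parts separately;
    its coefficients are therefore in weak [l_2]. *)
Lemma functional_le_of_ternary (a : 'I_n -> K) (B : R) : 0 <= B ->
  (forall v, modulus (\sum_i ternary_vec v 0 i * a i) <= B * euclid (ternary_vec v)) ->
  forall u : 'rV[K]_n, modulus (\sum_i u 0 i * a i) <=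
    2 * B * Num.sqrt (harmonic_sum R n) * euclid u.
Proof.
move=> B0 aB u.
have part (f : K -> R) : (forall x y, f (x + y) = f x + f y) -> f 0 = 0 ->
    (forall r x, f (of_real F r * x) = r * f x) ->
    (forall x, `|f x| <= modulus x) ->
    forall S : {set 'I_n}, \sum_(i in S) `|f (a i)| <= B * Num.sqrt #|S|%:R.
  move=> fD f0 fZ fle S.
  pose v := [ffun i => if i \in S then Some (f (a i) < 0) else None].
  have -> : Num.sqrt #|S|%:R = euclid (ternary_vec v).
    congr Num.sqrt; rewrite -sumr_const big_mkcond; apply: eq_bigr => i _.
    rewrite mxE modulus_of_real ffunE /ternary /sgn.
    by case: ifP => _; rewrite ?normrX ?normrN1 ?expr1n // normr0 expr0n.
  apply: le_trans (aB v); apply: le_trans (fle _).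
  rewrite (big_morph f fD f0) big_mkcond /=.
  apply: le_trans (ler_norm _); apply: ler_sum => i _.
  rewrite mxE fZ ffunE /ternary /sgn; case: ifP => _; last by rewrite mul0r.
  by rewrite normrEsign.
have weak (S : {set 'I_n}) :
    \sum_(i in S) modulus (a i) <= 2 * B * Num.sqrt #|S|%:R.
  have hre := part _ (@re_partD R F) (re_part0 R F) (@re_partZ R F) (@re_part_le R F) S.
  have him := part _ (@im_partD R F) (im_part0 R F) (@im_partZ R F) (@im_part_le R F) S.
  apply: le_trans (_ : _ <= \sum_(i in S) (`|re_part (a i)| + `|im_part (a i)|)) _.
    by apply: ler_sum => i _; exact: modulus_le_parts.
  by rewrite big_split; apply: le_trans (lerD hre him) _; rewrite -mulrA mulr_natl mulr2n.
have l2 : \sum_i modulus (a i) ^+ 2 <= (2 * B) ^+ 2 * harmonic_sum R n.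
  have := weak_l2 (fun i => modulus_ge0 (a i)) weak [set: 'I_n].
  by rewrite cardsT card_ord; under eq_bigl do rewrite inE.
apply: le_trans (modulus_sum _ _) _; under eq_bigr do rewrite modulusM.
rewrite -(ler_pXn2r (n := 2)) ?nnegrE //; last 2 first.
- by apply: sumr_ge0 => i _; rewrite mulr_ge0 ?modulus_ge0.
- by rewrite !mulr_ge0 ?sqrtr_ge0 ?euclid_ge0.
apply: le_trans (sum_cauchy_schwarz _ _ _) _.
rewrite !exprMn !sqr_sqrtr ?harmonic_sum_ge0 //; last first.
  by apply: sumr_ge0 => i _; exact: sqr_ge0.
rewrite mulrC -exprMn; apply: ler_wpM2r l2.
by apply: sumr_ge0 => i _; exact: sqr_ge0.
Qed.

Lemma multilinear_vcons (m : nat) (A : ('I_m.+1 -> 'rV[K]_n) -> K) u :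
  multilinear_form A -> multilinear_form (fun z : 'I_m -> 'rV[K]_n => A (vcons u z)).
Proof.
by move=> lA z k a v w /=; rewrite -!(replace_at_vconsS u); exact: lA.
Qed.

(** Passing from sign vectors to arbitrary vectors one position at a time, each
    step being the linear case applied with the other arguments fixed. *)
Lemma multilinear_le_of_ternary (m : nat) (A : ('I_m -> 'rV[K]_n) -> K) (B : R) :
  multilinear_form A -> 0 <= B ->
  (forall v : {ffun 'I_m -> {ffun 'I_n -> option bool}},
    modulus (A (fun k => ternary_vec (v k))) <=
    B * \prod_k euclid (ternary_vec (v k))) ->
  forall z, modulus (A z) <=
    B * (2 * Num.sqrt (harmonic_sum R n)) ^+ m * \prod_k euclid (z k).
Proof.
elim: m A B => [|m IH] A B lA B0 AB z.
  have v : {ffun 'I_0 -> {ffun 'I_n -> option bool}} by apply: finfun => -[].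
  have := AB v; rewrite !big_ord0 expr0 !mulr1.
  by rewrite (_ : (fun k => ternary_vec (v k)) = z) //; apply: funext => -[].
set H := 2 * Num.sqrt _.
have H0 : 0 <= H by rewrite mulr_ge0 ?sqrtr_ge0.
rewrite big_ord_recl exprS -[in leLHS](vcons_eta z).
rewrite (_ : _ * _ = B * H * euclid (z ord0) * H ^+ m *
   \prod_k euclid (z (lift ord0 k))); last by ring.
apply: (IH (fun z' => A (vcons (z ord0) z'))).
- exact: multilinear_vcons.
- by rewrite !mulr_ge0 ?euclid_ge0.
move=> v.
pose P := \prod_k euclid (ternary_vec (v k)).
have P0 : 0 <= P by apply: prodr_ge0 => k _; exact: euclid_ge0.
pose w k := ternary_vec (v k).
have split u : A (vcons u w) = \sum_i u 0 i * A (vcons (delta_mx 0 i) w).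
  rewrite [in LHS](row_sum_delta u) -(replace_at_vcons0 0) multilinear_sum //.
  by apply: eq_bigr => i _; rewrite replace_at_vcons0.
rewrite -/w -/P split.
apply: le_trans (functional_le_of_ternary (mulr_ge0 B0 P0) _ _) _.
  move=> v0; rewrite -split.
  have := AB (fcons v0 v); rewrite big_ord_recl fcons0.
  rewrite (_ : (fun k => ternary_vec (fcons v0 v k)) = vcons (ternary_vec v0) w).
    under eq_bigr do rewrite fconsS.
    by rewrite -/P mulrAC mulrA.
  apply: funext => k; rewrite /vcons ffunE.
  by case: unliftP.
rewrite le_eqVlt; apply/orP; left; apply/eqP; rewrite /H; ring.
Qed.

(** Hölder's inequality for two copies of the same vector. *)
Lemma euclid_in_ball (q : \bar R) (u : 'rV[K]_n) : (0 < n)%N -> (2 <= q)%E ->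
  lnorm q (fun i => modulus (u 0 i)) <= 1 ->
  euclid u <= n%:R `^ (2^-1 - rinv q).
Proof.
move=> n0 q2 uq.
have q0 : (0 < q)%E by apply: lt_le_trans q2.
have rq : rinv q <= 2^-1.
  case: q q2 {uq} q0 => [r||] // q2 q0; last by rewrite rinvy invr_ge0.
  by rewrite rinvE // lef_pV2 // posrE.
have := @holder_in_balls R 2 n (fun=> q) (fun _ i => modulus (u 0 i)) predT n0.
rewrite !big_ord_recl big_ord0 addr0.
under eq_bigr do rewrite !big_ord_recl big_ord0 mulr1 -expr2.
move=> h; rewrite -(ler_pXn2r (n := 2)) ?nnegrE ?powR_ge0 ?euclid_ge0 //.
rewrite sqr_sqrtr; last by apply: sumr_ge0 => i _; exact: sqr_ge0.
rewrite -powR_mulrn ?powR_ge0 // -powRrM.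
have -> : (2^-1 - rinv q) * 2 = 1 - (rinv q + rinv q) by field.
apply: h => //; first by move=> _ i; exact: modulus_ge0.
lra.
Qed.

End EuclideanBalls.

(** * Sharpness of the exponents beyond the critical position *)

Section Sharpness.
Variables (R : realType) (F : scalar_kind) (m : nat) (p : 'I_m -> \bar R).
Variable k0 : 'I_m.
Hypothesis p1 : forall k, (1 <= p k)%E.
Hypothesis tsum0 : tsum p 0 = 1.
Hypothesis k0P : is_k0 p k0.
Hypothesis pk0 : (2 <= p k0)%E.
Local Notation K := (scalars R F).

Lemma p_ge2 (l : 'I_m) : (k0 <= l)%N -> (2 <= p l)%E.
Proof.
rewrite leq_eqVlt => /orP[/eqP/val_inj <- //|k0l].
have : rinv (p l) < 2^-1.
  apply: le_lt_trans (tsum_gt_k0 p1 k0P k0l).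
  rewrite tsum_recl lerDl; apply: sumr_ge0 => j _; exact: rinv_p_ge0.
have := le1e_gt0 p1 l; case: (p l) => [r||] //; last by rewrite leey.
by rewrite lte_fin => r0; rewrite rinvE // ltf_pV2 ?posrE // => /ltW.
Qed.

(** Freezing the positions before [k0] makes both sides of the inequality
    insensitive to the exponents there. *)
Definition box_coef (n : nat) (o : 'I_n) (e : {ffun {ffun 'I_m -> 'I_n} -> bool})
    (j : {ffun 'I_m -> 'I_n}) : K :=
  if [forall l : 'I_m, (l < k0)%N ==> (j l == o)] then of_real F (sgn R (e j)) else 0.

(** On the positions from [k0] on, [p l >= 2] allows one to pass from the ball of
    [l_(p l)] to the Euclidean ball at the cost of [n ^ (1/2 - 1/p_l)]; a frozen
    position contributes a single coordinate, of modulus at most 1. *)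
Lemma box_form_norm (n : nat) (o : 'I_n) :
  exists e, form_norm p (tensor_form (box_coef o e)) <=
    Num.sqrt (16 * m.+1%:R * n%:R) * (2 * Num.sqrt (harmonic_sum R n)) ^+ m *
    \prod_(l < m | (k0 <= l)%N) n%:R `^ (2^-1 - rinv (p l)).
Proof.
have n0 : (0 < n)%N by apply: leq_ltn_trans (ltn_ord o).
have p0 := le1e_gt0 p1.
have [e eP] := exists_sign_tensor R m n0; exists e.
pose E := tensor_form (fun j => of_real F (sgn R (e j))).
have EP (v : {ffun 'I_m -> {ffun 'I_n -> option bool}}) :
    modulus (E (fun k => ternary_vec R F (v k))) <=
    Num.sqrt (16 * m.+1%:R * n%:R) * \prod_k euclid (ternary_vec R F (v k)).
  have -> : E (fun k => ternary_vec R F (v k)) = of_real F (tensor_test R e v).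
    rewrite of_real_sum; apply: eq_bigr => j _; rewrite of_realM of_real_prod mulrC.
    by congr (_ * _); apply: eq_bigr => k _; rewrite mxE.
  rewrite modulus_of_real; apply: le_trans (eP v) _.
  rewrite [leLHS]sqrtrM ?mulr_ge0 ?ler0n //; apply: ler_wpM2l; first exact: sqrtr_ge0.
  rewrite (_ : box_size R v = (\prod_k euclid (ternary_vec R F (v k))) ^+ 2).
    by rewrite sqrtr_sqr ger0_norm // prodr_ge0 // => k _; exact: euclid_ge0.
  rewrite -prodrXl; apply: eq_bigr => k _; rewrite sqr_sqrtr.
    apply: eq_bigr => i _.
    by rewrite mxE modulus_of_real real_normK ?num_real.
  by apply: sumr_ge0 => i _; exact: sqr_ge0.
apply: form_norm_le => // z zb.
pose z' (l : 'I_m) : 'rV[K]_n := \row_i (if (l < k0)%N && (i != o) then 0 else z l 0 i).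
have -> : tensor_form (box_coef o e) z = E z'.
  apply: eq_bigr => j _; rewrite /box_coef; case: ifP => jo.
    congr (_ * _); apply: eq_bigr => l _; rewrite mxE.
    by have /forallP/(_ l) := jo; case: (l < k0)%N => //= /eqP ->; rewrite eqxx.
  move/negbT: jo; rewrite negb_forall => /existsP[l]; rewrite negb_imply => ljo.
  by rewrite mulr0 (bigD1 l) //= mxE ljo !mul0r.
apply: le_trans (multilinear_le_of_ternary (tensor_form_multilinear _)
  (sqrtr_ge0 _) EP z') _.
apply: ler_wpM2l.
  by rewrite mulr_ge0 ?exprn_ge0 ?sqrtr_ge0 // mulr_ge0 ?sqrtr_ge0.
rewrite [leRHS]big_mkcond; apply: ler_prod => l _; rewrite euclid_ge0 /=.
case: leqP => lk0.
  rewrite (_ : z' l = z l); last first.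
    by apply/rowP => i; rewrite mxE ltnNge lk0.
  by apply: euclid_in_ball => //; exact: p_ge2.
rewrite /euclid (bigD1 o) //= big1 ?addr0; last first.
  by move=> i io; rewrite mxE lk0 io /= modulus0 expr0n.
rewrite sqrtr_sqr ger0_norm ?modulus_ge0 // mxE eqxx andbF.
exact: in_ball_coord zb.
Qed.

Lemma prod_powR (x : R) (P : pred 'I_m) (f : 'I_m -> R) : x != 0 ->
  \prod_(l | P l) x `^ f l = x `^ (\sum_(l | P l) f l).
Proof.
move=> x0; elim/big_ind2: _ => [|a r b s -> ->|//]; first by rewrite powRr0.
by rewrite powRD // x0 implybT.
Qed.

(** On a box of side [n] the two sides of the inequality are [n] to the powers
    [sum_(l >= k0) 1/t_l] and, up to a logarithm,
    [1/2 + sum_(l >= k0) (1/2 - 1/p_l)].  For the exponents of the theorem these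
    powers coincide, so that no [2] can be lowered. *)
Lemma not_admissible_lower (k : 'I_m) (t' : \bar R) : (k0 < k)%N ->
  (0 < t')%E -> (t' < 2)%E -> ~ admissible F p (replace_at (exponent p k0) k t').
Proof.
move=> k0k; case: t' => [r||] // r0 r2 [s0 [C sC]].
rewrite !lte_fin in r0 r2.
have : r^-1 - 2^-1 <= 0; last first.
  by rewrite subr_le0 lef_pV2 ?posrE // leNgt r2.
pose kap : R := Num.sqrt (16 * m.+1%:R).
apply: (@powR_growth _ _ (`|C| * kap * 2 ^+ m) m) => N.
set n := (2 ^ N)%N; have n0 : (0 < n)%N by rewrite expn_gt0.
have nR : n%:R != 0 :> R by rewrite pnatr_eq0 -lt0n.
have nP : 0 < n%:R :> R by rewrite ltr0n.
pose o := Ordinal n0.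
have [e eP] := box_form_norm o.
pose A := tensor_form (box_coef o e).
have lA : multilinear_form A by exact: tensor_form_multilinear.
set s := replace_at _ _ _ in s0 sC.
have lower : \prod_(l < m | (k0 <= l)%N) n%:R `^ rinv (s l) <=
    mixed_norm s (form_coef A).
  apply: (mixed_norm_ge_box (o := o)) => // [j|j jo]; first exact: modulus_ge0.
  rewrite tensor_form_coef /box_coef ifT; last first.
    apply/forallP => l; apply/implyP => lk0; rewrite ffunE jo //.
    by rewrite -ltnNge.
  by rewrite modulus_of_real /sgn normrX normrN1 expr1n.
have upper := le_trans lower (le_trans (sC _ _ n0 lA)
  (le_trans (ler_wpM2r (form_norm_ge0 (le1e_gt0 p1) lA) (ler_norm C))
            (ler_wpM2l (normr_ge0 C) eP))).
move: upper; rewrite !prod_powR //.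
have -> : \sum_(l < m | (k0 <= l)%N) rinv (s l) =
    (r^-1 - 2^-1) + (2^-1 + \sum_(l < m | (k0 <= l)%N) (2^-1 - rinv (p l))).
  have sE (l : 'I_m) : (k0 <= l)%N -> rinv (s l) =
      2^-1 + ((if l == k0 then 2^-1 - tsum p k0 else 0) +
              (if l == k then r^-1 - 2^-1 else 0)).
    move=> k0l; rewrite /s /replace_at; case: (eqVneq l k) => [->|lk].
      by rewrite -val_eqE /= gtn_eqF // rinvE // add0r addrC subrK.
    rewrite addr0 rinv_exponent //; case: (eqVneq l k0) => [->|lk0].
      by rewrite leqnn; field.
    have k0l' : (k0 < l)%N by rewrite ltn_neqAle k0l andbT eq_sym; exact: lk0.
    by rewrite addr0 leqNgt k0l'.
  rewrite (eq_bigr _ sE) big_split big_split /= sumrB -/(tsum p k0).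
  have pick (c : R) (l0 : 'I_m) : (k0 <= l0)%N ->
      \sum_(l < m | (k0 <= l)%N) (if l == l0 then c else 0) = c.
    move=> kl0; rewrite -big_mkcondr (big_pred1 l0) // => l /=.
    by case: eqP => [->|]; rewrite ?andbF // kl0.
  by rewrite !pick ?(ltnW k0k) //; field; rewrite gt_eqF.
rewrite !powRD ?nR ?implybT // powR12_sqrt ?ler0n //.
rewrite sqrtrM ?mulr_ge0 ?ler0n // -/kap.
set X := n%:R `^ (\sum_(l < m | _) _); set G := n%:R `^ _; set Y := Num.sqrt n%:R.
have X0 : 0 < X by exact: powR_gt0.
have Y0 : 0 < Y by rewrite sqrtr_gt0.
set H := (2 * _) ^+ m.
have HN : H <= 2 ^+ m * N.+1%:R ^+ m.
  have N1 : (1 : R) <= N.+1%:R by rewrite ler1n.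
  rewrite -exprMn; apply: lerXn2r; rewrite ?nnegrE ?mulr_ge0 ?sqrtr_ge0 ?ler0n //.
  rewrite ler_pM2l // -(ler_pXn2r (n := 2)) ?nnegrE ?sqrtr_ge0 ?ler0n //.
  rewrite sqr_sqrtr ?harmonic_sum_ge0 //.
  apply: le_trans (harmonic_sum_pow2 R N) _.
  by rewrite expr2 ler_peMr // ler0n.
have -> : `|C| * (kap * Y * H * X) = (`|C| * kap * H) * (Y * X) by ring.
rewrite ler_pM2r ?mulr_gt0 // => h; apply: le_trans h _.
by rewrite -[leRHS]mulrA ler_wpM2l // mulr_ge0 ?sqrtr_ge0.
Qed.

End Sharpness.

Theorem proposition6p2 (R : realType) (m : nat) (hm : (2 <= m)%N) :
  exists C : R, forall (F : scalar_kind) (p : 'I_m -> \bar R) (k0 : 'I_m),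
    (forall k, (1 <= p k)%E) ->
    (2^-1 <= tail_sum p 1)%E ->
    (tail_sum p 1 < 1)%E ->
    tail_sum p 0 = 1%E ->
    is_k0 p k0 ->
    (forall (n : nat) (A : ('I_m -> 'rV[scalars R F]_n) -> scalars R F),
        (0 < n)%N -> multilinear_form A ->
        mixed_norm (exponent p k0) (form_coef A) <= C * form_norm p A) /\
    (forall k : 'I_m, (k <= k0)%N -> optimal_at F p (exponent p k0) k) /\
    ((2 <= p k0)%E -> globally_sharp F p (exponent p k0)).
Proof.
exists (2 * Num.sqrt (3 ^+ m)) => F p k0 p1 _ _ T0 k0P.
have tsum0 : tsum p 0 = 1 by move: T0; rewrite tail_sumE // => -[].
have ineq n (A : ('I_m -> 'rV[scalars R F]_n) -> scalars R F) :
    (0 < n)%N -> multilinear_form A ->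
    mixed_norm (exponent p k0) (form_coef A) <=
    2 * Num.sqrt (3 ^+ m) * form_norm p A.
  by move=> _ lA; exact: mixed_norm_exponent_le.
have opt (k : 'I_m) : (k <= k0)%N -> optimal_at F p (exponent p k0) k.
  exact: exponent_optimal.
split=> //; split=> // pk0; split.
  split; first exact: exponent_gt0.
  by exists (2 * Num.sqrt (3 ^+ m)).
move=> k t' t'0 t's; case: (leqP k k0) => kk0.
  move=> adm; have := opt k kk0 _ adm.
  by rewrite /replace_at eqxx leNgt t's.
apply: not_admissible_lower => //.
by move: t's; rewrite /exponent leqNgt kk0.
Qed.
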